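(* Let $P$ be a $d$-polytope with slack ideal $I_P$ and non-incidence toric ideal $T_P$ (defined in the context). Then $I_P=T_P$ if and only if $P$ is projectively unique and $I_P$ is a toric ideal.
   Context: Let $P\subset\mathbb{R}^d$ be a $d$-dimensional polytope with labelled vertices $\mathbf p_1,\dots,\mathbf p_v$ and labelled facets $F_1,\dots,F_f$. The symbolic slack matrix $S_P(\mathbf x)$ is the $v\times f$ matrix with a $0$ in entry $(i,j)$ if $\mathbf p_i\in F_j$ and a distinct variable $x_{ij}$ otherwise; let $x_1,\dots,x_t$ denote all these variables. The slack ideal is $I_P=\langle (d+2)\text{-minors of } S_P(\mathbf x)\rangle : (x_1\cdots x_t)^\infty\subseteq\mathbb{C}[x_1,\dots,x_t]$. The non-incidence graph $G_P$ is the bipartite graph on the vertices and facets of $P$ with an edge $\{\mathbf p_i,F_j\}$ iff $\mathbf p_i\notin F_j$ (labelled by $x_{ij}$). $T_P$ is the toric ideal of the vertex-edge incidence matrix of $G_P$, i.e. the kernel of the map $x_{ij}\mapsto s_iu_j$ into the Laurent polynomial ring $\mathbb{C}[s_1^{\pm1},\dots,s_v^{\pm1},u_1^{\pm1},\dots,u_f^{\pm1}]$. An ideal of $\mathbb{C}[x_1,\dots,x_t]$ is toric if it is the kernel of a map $x_j\mapsto \mathbf z^{\mathbf a_j}$ into a Laurent polynomial ring $\mathbb{C}[z_1^{\pm1},\dots,z_n^{\pm1}]$ for some $\mathbf a_1,\dots,\mathbf a_t\in\mathbb{Z}^n$. $P$ is projectively unique if every polytope combinatorially equivalent to $P$ is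 projectively equivalent to $P$. *)

(* Defs.v *)
From HB Require Import structures.
From mathcomp Require Import all_boot all_order all_algebra.
From mathcomp Require Import Rstruct.
From mathcomp Require Import complex.
From mathcomp Require Import mpoly.
From Stdlib Require Import Rdefinitions.

Set Implicit Arguments.
Unset Strict Implicit.
Unset Printing Implicit Defensive.

Import Order.TTheory GRing.Theory Num.Theory.
Local Open Scope ring_scope.

Section Geometry.
Variable d : nat.

Definition dotp (a x : 'rV[R]_d) : R := (a *m x^T) 0 0.

Definition in_conv_on (v : nat) (A : pred 'I_v) (p : 'I_v -> 'rV[R]_d)
  (x : 'rV[R]_d) : Prop :=
  exists lam : 'I_v -> R,
    [/\ forall k, 0 <= lam k,
        forall k, ~~ A k -> lam k = 0,
        \sum_k lam k = 1
      & x = \sum_k lam k *: p k].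

Definition in_conv (v : nat) (p : 'I_v -> 'rV[R]_d) (x : 'rV[R]_d) : Prop :=
  in_conv_on predT p x.

(* p_1, ..., p_v are exactly the vertices of conv(p): no p_i is a convex
   combination of the other p_k (this also forces the p_i to be distinct) *)
Definition vertex_family (v : nat) (p : 'I_v -> 'rV[R]_d) : Prop :=
  forall i, ~ in_conv_on (predC1 i) p (p i).

Definition aff_indep (k : nat) (q : 'I_k -> 'rV[R]_d) : bool :=
  row_free (\matrix_(i < k) row_mx (q i) (1 : 'rV[R]_1)).

Definition full_dim (v : nat) (p : 'I_v -> 'rV[R]_d) : Prop :=
  exists r : 'I_d.+1 -> 'rV[R]_d, (forall k, in_conv p (r k)) /\ aff_indep r.

Definition valid_ineq (v : nat) (p : 'I_v -> 'rV[R]_d) (a : 'rV[R]_d) (b : R)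
  : Prop := forall x, in_conv p x -> dotp a x <= b.

(* {x in conv(p) | <a, x> = b} is a facet of conv(p): a face cut out by a
   supporting hyperplane (a <> 0), of dimension d-1 (it contains d affinely
   independent points; it cannot contain more as it lies in a hyperplane) *)
Definition facet_ineq (v : nat) (p : 'I_v -> 'rV[R]_d) (a : 'rV[R]_d) (b : R)
  : Prop :=
  [/\ a != 0, valid_ineq p a b &
      exists q : 'I_d -> 'rV[R]_d,
        (forall k, in_conv p (q k) /\ dotp a (q k) = b) /\ aff_indep q].

Definition facet_labelling (v f : nat) (p : 'I_v -> 'rV[R]_d)
  (F : 'I_f -> 'rV[R]_d * R) : Prop :=
  [/\ forall j, facet_ineq p (F j).1 (F j).2,
      forall j k, (forall x, in_conv p x ->
                    (dotp (F j).1 x = (F j).2 <-> dotp (F k).1 x = (F k).2)) ->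
                  j = k
    & forall a b, facet_ineq p a b -> exists j, forall x, in_conv p x ->
                    (dotp a x = b <-> dotp (F j).1 x = (F j).2)].

Definition incident (v f : nat) (p : 'I_v -> 'rV[R]_d)
  (F : 'I_f -> 'rV[R]_d * R) (i : 'I_v) (j : 'I_f) : bool :=
  dotp (F j).1 (p i) == (F j).2.

(* S is the vertex set of a face of conv(p) (including the empty face and
   conv(p) itself, obtained from a = 0) *)
Definition is_face (v : nat) (p : 'I_v -> 'rV[R]_d) (S : {set 'I_v}) : Prop :=
  exists a b, valid_ineq p a b /\ S = [set i | dotp a (p i) == b].

Definition comb_equiv (v w : nat) (p : 'I_v -> 'rV[R]_d)
  (q : 'I_w -> 'rV[R]_d) : Prop :=
  exists phi : {set 'I_v} -> {set 'I_w},
    [/\ forall S, is_face p S -> is_face q (phi S),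
        forall T, is_face q T -> exists2 S, is_face p S & phi S = T
      & forall S S', is_face p S -> is_face p S' ->
           (S \subset S') = (phi S \subset phi S')].

Definition hom_img (M : 'M[R]_(d + 1)) (x : 'rV[R]_d) : 'rV[R]_(d + 1) :=
  row_mx x (1 : 'rV[R]_1) *m M.

(* the projective transformation x |-> (x A + b) / (<x, c> + g) given by
   M = [[A, c], [b, g]] *)
Definition proj_map (M : 'M[R]_(d + 1)) (x : 'rV[R]_d) : 'rV[R]_d :=
  ((rsubmx (hom_img M x)) 0 0)^-1 *: lsubmx (hom_img M x).

Definition proj_equiv (v w : nat) (p : 'I_v -> 'rV[R]_d)
  (q : 'I_w -> 'rV[R]_d) : Prop :=
  exists M : 'M[R]_(d + 1),
    [/\ M \in unitmx,
        forall x, in_conv p x -> (rsubmx (hom_img M x)) 0 0 != 0,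
        forall x, in_conv p x -> in_conv q (proj_map M x)
      & forall y, in_conv q y -> exists2 x, in_conv p x & proj_map M x = y].

Definition proj_unique (v : nat) (p : 'I_v -> 'rV[R]_d) : Prop :=
  forall (w : nat) (q : 'I_w -> 'rV[R]_d),
    vertex_family q -> comb_equiv p q -> proj_equiv p q.

End Geometry.

Section Ideals.
Variables (K : fieldType) (n : nat).
Local Notation P := {mpoly K[n]}.

Definition ideal_gen (S : P -> Prop) (g : P) : Prop :=
  exists s : seq (P * P),
    (forall c, c \in s -> S c.2) /\ g = \sum_(c <- s) c.1 * c.2.

Definition saturate (I : P -> Prop) (g : P) : Prop :=
  exists N : nat, I ((\prod_(i < n) 'X_i) ^+ N * g).

(* kernel of the K-algebra map K[x] -> K[z_1^{+-1}, ..., z_m^{+-1}],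
   x_j |-> z^{a_j}; the Laurent ring is the group algebra of Z^m, so g is in
   the kernel iff for every b in Z^m the coefficient of z^b in the image,
   i.e. the sum of the coefficients g_mu over the exponents mu with
   sum_j mu_j a_j = b, vanishes *)
Definition laurent_kernel (m : nat) (a : 'I_n -> 'rV[int]_m) (g : P) : Prop :=
  forall b : 'rV[int]_m,
    \sum_(mu <- msupp g | \sum_(j < n) (a j) *+ (mu j) == b) g@_mu = 0.

Definition is_toric (I : P -> Prop) : Prop :=
  exists (m : nat) (a : 'I_n -> 'rV[int]_m),
    forall g, I g <-> laurent_kernel a g.

End Ideals.

Section Slack.
Variables (d v f : nat) (p : 'I_v -> 'rV[R]_d) (F : 'I_f -> 'rV[R]_d * R).

(* non-incident pairs (i, j), i.e. edges of the non-incidence graph G_P;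
   they index the variables x_ij of the slack matrix *)
Definition nonincid : predArgType :=
  {ij : 'I_v * 'I_f | ~~ incident p F ij.1 ij.2}.

Definition nvars : nat := #|nonincid|.

Definition slack_ring := {mpoly (complex R)[nvars]}.

Definition slack_matrix : 'M[slack_ring]_(v, f) :=
  \matrix_(i, j)
     oapp (fun u : nonincid => 'X_(enum_rank u)) 0 (insub (i, j)).

(* the k-minors of a matrix (up to sign) *)
Definition minors (k : nat) (A : 'M[slack_ring]_(v, f)) (g : slack_ring)
  : Prop :=
  exists (r : 'I_k -> 'I_v) (c : 'I_k -> 'I_f),
    [/\ injective r, injective c & g = \det (mxsub r c A)].

Definition slack_ideal : slack_ring -> Prop :=
  saturate (ideal_gen (minors (d + 2) slack_matrix)).

(* exponent of the image s_i u_j of x_ij in the Laurent ring in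
   s_1..s_v, u_1..u_f (column of the vertex-edge incidence matrix of G_P) *)
Definition nonincid_exp (k : 'I_nvars) : 'rV[int]_(v + f) :=
  let u := (enum_val k : nonincid) in
  delta_mx 0 (lshift f (val u).1) + delta_mx 0 (rshift v (val u).2).

Definition nonincidence_toric : slack_ring -> Prop :=
  laurent_kernel nonincid_exp.

End Slack.

Arguments slack_ideal {d v f} p F _.
Arguments nonincidence_toric {d v f} p F _.
Arguments slack_matrix {d v f} p F.
Arguments nvars {d v f} p F.
Arguments slack_ring {d v f} p F.

(* Main.v *)
(* Identify a nonnegative matrix having the zero pattern of the slack matrix of P with a
   point of the positive part of the slack variety; on such points the slack ideal
   vanishes exactly when the rank is at most d+1.

   The main geometric fact is that every such matrix M of rank at most d+1 is, up to
   positive row scalings, the slack matrix of a polytope combinatorially equivalent to P.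
   Along a maximal chain of faces of P the rank of the corresponding rows of M drops at
   each step, so by the rank bound it drops by exactly one; hence inside every face a
   vector of the column space of M vanishing on a facet is a multiple of the column of
   that facet. By induction on faces, the nonnegative vectors in the column space of M
   are then nonnegative combinations of its columns, and the face lattice can be read off
   from the zero pattern.

   If I_P = T_P, the slack matrix of any polytope combinatorially equivalent to P is a
   positive point of the toric variety of T_P, so by taking logarithms it has entries
   s_i u_j, as does that of P; the two differ by positive row and column scalings, which
   is projective equivalence.

   Conversely, if P is projectively unique and I_P is the kernel of x_k |-> z^(a_k), the
   all-ones point and the points x_k = 2^((a_k)_l) lie on the slack variety. By projective
   uniqueness each is a scaling of the slack matrix of P up to a permutation of rows and
   columns. The all-ones point shows that the latter has entries s_i u_j, and therefore so
   do the points x_k = 2^((a_k)_l): monomials with the same image in T_P have the same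
   exponent sum of the a_k. *)
Require Import Defs.
From HB Require Import structures.
From Stdlib Require Import Rdefinitions Rpower Exp_prop.
From mathcomp Require Import all_boot all_order all_algebra zify ring lra.
From mathcomp Require Import Rstruct.
From mathcomp Require Import complex.
From mathcomp Require Import mpoly.
Set Implicit Arguments.
Unset Strict Implicit.
Unset Printing Implicit Defensive.
Import Order.TTheory GRing.Theory Num.Theory.
Local Open Scope ring_scope.

(** * Farkas' lemma and row restrictions of matrices *)

Section Farkas.
Variable K : realFieldType.

(* Bartl's induction: if the certificate [z] for the first [n] generators is negative
   on the last one, replace every vector by its projection along the last generator
   onto the kernel of [z]. *)
Lemma farkas_nat (m n : nat) (al : nat -> 'cV[K]_m) (c : 'cV[K]_m) :
  (exists lam : nat -> K, (forall i, 0 <= lam i) /\ c = \sum_(i < n) lam i *: al i)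
  \/ (exists z : 'rV[K]_m,
        (forall i, (i < n)%N -> 0 <= (z *m al i) 0 0) /\ (z *m c) 0 0 < 0).
Proof.
elim: n al c => [|n IHn] al c.
  have [->|c0] := eqVneq c 0.
    by left; exists (fun=> 0); split=> //; rewrite big_ord0.
  right; exists (- c^T); split=> //.
  rewrite mulNmx mxE oppr_lt0 mxE lt0r; apply/andP; split; last first.
    by apply: sumr_ge0 => i _; rewrite mxE -expr2 sqr_ge0.
  apply: contra c0 => /eqP cc0; apply/eqP/colP => i; rewrite mxE.
  have sq0 k : 0 <= c^T 0 k * c k 0 by rewrite mxE -expr2 sqr_ge0.
  have /eqP := psumr_eq0P (fun k _ => sq0 k) cc0 (i := i) isT.
  by rewrite mxE -expr2 sqrf_eq0 => /eqP.
have [[lam [lam0 cE]]|[z [z0 zc]]] := IHn al c.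
  left; exists (fun i => if i == n then 0 else lam i); split=> [i|]; first by case: ifP.
  rewrite big_ord_recr /= eqxx scale0r addr0 {1}cE; apply: eq_bigr => i _.
  by rewrite ltn_eqF.
have [za|za] := lerP 0 ((z *m al n) 0 0).
  by right; exists z; split=> // i; rewrite ltnS leq_eqVlt => /orP[/eqP->|/z0].
set a := al n in za *.
wlog za1 : z z0 zc za / (z *m a) 0 0 = -1.
  move=> /(_ ((- (z *m a) 0 0)^-1 *: z)); apply.
  - move=> i ilt; rewrite -scalemxAl mxE mulr_ge0 ?invr_ge0 ?z0 //; lra.
  - by rewrite -scalemxAl mxE pmulr_rlt0 // invr_gt0 oppr_gt0.
  - by rewrite -scalemxAl mxE pmulr_rlt0 // invr_gt0 oppr_gt0.
  - by rewrite -scalemxAl mxE invrN mulNr mulVf // lt_eqF.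
have [[lam [lam0 cE]]|[z1 [z10 z1c]]] :=
   IHn (fun i => al i + (z *m al i) 0 0 *: a) (c + (z *m c) 0 0 *: a).
  (* Undoing the projections collects their terms into the coefficient [u] of [a]; it is nonnegative
     since [z] is negative on [c] and nonnegative on the first [n] generators. *)
  left; pose u := \sum_(i < n) lam i * (z *m al i) 0 0 - (z *m c) 0 0.
  have u0 : 0 <= u.
    by rewrite subr_ge0 (le_trans (ltW zc)) // sumr_ge0 // => i _; rewrite mulr_ge0 ?z0.
  exists (fun i => if i == n then u else lam i); split=> [i|]; first by case: ifP.
  rewrite big_ord_recr /= eqxx /u.
  rewrite -[LHS](addrK ((z *m c) 0 0 *: a)) cE scalerBl addrA scaler_suml -big_split /=.
  congr (_ - _); apply: eq_bigr => i _.
  by rewrite ltn_eqF // scalerDr scalerA.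
(* Composing [z1] with the projection gives this functional, which vanishes on [a]. *)
have zE i : ((z1 + (z1 *m a) 0 0 *: z) *m i) 0 0 = (z1 *m (i + (z *m i) 0 0 *: a)) 0 0.
  rewrite mulmxDl mulmxDr -scalemxAl -scalemxAr !mxE; congr (_ + _); exact: mulrC.
right; exists (z1 + (z1 *m a) 0 0 *: z); split=> [i|]; last by rewrite zE.
rewrite ltnS leq_eqVlt => /orP[/eqP->|iln]; last by rewrite zE; exact: z10.
by rewrite -/a zE za1 scaleN1r subrr mulmx0 mxE.
Qed.

Lemma farkas (m n : nat) (B : 'M[K]_(m, n)) (c : 'cV[K]_m) :
  (exists lam : 'cV[K]_n, (forall i, 0 <= lam i 0) /\ c = B *m lam)
  \/ (exists z : 'rV[K]_m,
        (forall j, 0 <= (z *m B) 0 j) /\ (z *m c) 0 0 < 0).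
Proof.
have [[lam [lam0 cE]]|[z [z0 zc]]] :=
  @farkas_nat m n (fun i => if insub i is Some j then col j B else 0) c; last first.
  right; exists z; split=> // j; have := z0 _ (ltn_ord j).
  by rewrite valK !mxE; under eq_bigr do rewrite mxE.
left; exists (\col_i lam i); split=> [i|]; first by rewrite mxE.
rewrite cE; apply/colP => i; rewrite mxE summxE; apply: eq_bigr => j _.
by rewrite valK !mxE mulrC.
Qed.

End Farkas.

Section Mask.
Variable K : fieldType.
Implicit Types (v f : nat).

(** Rows outside [A] are zeroed rather than deleted, so that restrictions to different sets keep the
    same size. *)
Definition row_mask v f (A : {set 'I_v}) (N : 'M[K]_(v, f)) : 'M[K]_(v, f) :=
  \matrix_(i, j) if i \in A then N i j else 0.

Lemma row_maskE v f A (N : 'M[K]_(v, f)) i j :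
  row_mask A N i j = if i \in A then N i j else 0.
Proof. by rewrite mxE. Qed.

Lemma row_mask_mul v f g A (N : 'M[K]_(v, f)) (B : 'M[K]_(f, g)) :
  row_mask A N *m B = row_mask A (N *m B).
Proof.
apply/matrixP => i j; rewrite !mxE; case: ifP => iA; last first.
  by rewrite big1 // => k _; rewrite mxE iA mul0r.
by apply: eq_bigr => k _; rewrite mxE iA.
Qed.

Lemma row_mask_subset v f (A' A : {set 'I_v}) (N : 'M[K]_(v, f)) :
  A' \subset A -> row_mask A' N = row_mask A' 1%:M *m row_mask A N.
Proof.
move=> sA; rewrite row_mask_mul mul1mx; apply/matrixP => i j; rewrite !mxE.
by case: ifP => // /(subsetP sA) ->.
Qed.

Lemma row_maskT v f (N : 'M[K]_(v, f)) : row_mask setT N = N.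
Proof. by apply/matrixP => i j; rewrite mxE inE. Qed.

Lemma row_mask_mul_eqP v f A (N : 'M[K]_(v, f)) (y z : 'cV[K]_f) :
  row_mask A N *m y = row_mask A N *m z <-> {in A, forall i, (N *m y) i 0 = (N *m z) i 0}.
Proof.
rewrite !row_mask_mul; split=> [/matrixP e i iA|e].
  by have := e i 0; rewrite !row_maskE iA.
apply/matrixP => i j; rewrite ord1 !row_maskE; case: ifP => //; exact: e.
Qed.

Lemma row_mask_mul_eq0P v f A (N : 'M[K]_(v, f)) (y : 'cV[K]_f) :
  row_mask A N *m y = 0 <-> {in A, forall i, (N *m y) i 0 = 0}.
Proof.
have [H1 H2] := row_mask_mul_eqP A N y 0; rewrite mulmx0 in H1 H2.
split=> [/H1 h i iA|h]; first by rewrite h // mulmx0 mxE.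
by apply: H2 => i iA; rewrite h // mulmx0 mxE.
Qed.

(** Rank-nullity: the product on the left spans, up to transposition, the restrictions to [A] of the
    vectors $Ny$ that vanish on [A']. *)
Lemma mxrank_row_mask_gap v f (A' A : {set 'I_v}) (N : 'M[K]_(v, f)) :
  A' \subset A ->
  (\rank (kermx (row_mask A' N)^T *m (row_mask A N)^T) + \rank (row_mask A' N) =
   \rank (row_mask A N))%N.
Proof.
move=> sA; set N' := row_mask A' N; set NA := row_mask A N.
have := mxrank_mul_ker (kermx N'^T) NA^T.
have /capmx_idPr -> : (kermx NA^T <= kermx N'^T)%MS.
  by apply/sub_kermxP; rewrite /N' (row_mask_subset N sA) trmx_mul mulmxA mulmx_ker mul0mx.
rewrite !mxrank_ker !mxrank_tr.
have : (\rank NA <= f)%N by rewrite rank_leq_col.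
have : (\rank N' <= f)%N by rewrite rank_leq_col.
by have := mxrankS (submxMl (row_mask A' 1%:M) NA); rewrite -row_mask_subset //; lia.
Qed.

Lemma mxrank_row_mask_lt v f (A' A : {set 'I_v}) (N : 'M[K]_(v, f)) (y : 'cV[K]_f) i0 :
  A' \subset A -> {in A', forall i, (N *m y) i 0 = 0} ->
  i0 \in A -> (N *m y) i0 0 != 0 -> (\rank (row_mask A' N) < \rank (row_mask A N))%N.
Proof.
move=> sA y0 i0A yi0; rewrite -(mxrank_row_mask_gap N sA) -[ltnLHS]add0n ltn_add2r lt0n.
rewrite mxrank_eq0; apply: contra yi0 => /eqP e.
have /submxP[D yD] : (y^T <= kermx (row_mask A' N)^T)%MS.
  by apply/sub_kermxP; rewrite -trmx_mul (row_mask_mul_eq0P _ _ _).2 // trmx0.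
have /(congr1 trmx) : y^T *m (row_mask A N)^T = 0 by rewrite yD -mulmxA e mulmx0.
by rewrite -trmx_mul trmxK trmx0 => /row_mask_mul_eq0P ->.
Qed.

(** The gap space has dimension at most one and contains the nonzero restriction of $Nx$, hence is
    spanned by it. *)
Lemma mxrank_row_mask_prop v f (A' A : {set 'I_v}) (N : 'M[K]_(v, f)) (x y : 'cV[K]_f) i0 :
  A' \subset A -> (\rank (row_mask A N) <= (\rank (row_mask A' N)).+1)%N ->
  {in A', forall i, (N *m x) i 0 = 0} -> i0 \in A -> (N *m x) i0 0 != 0 ->
  {in A', forall i, (N *m y) i 0 = 0} ->
  exists t, {in A, forall i, (N *m y) i 0 = t * (N *m x) i 0}.
Proof.
move=> sA; rewrite -(mxrank_row_mask_gap N sA) -addn1 addnC leq_add2l => rk x0 i0A xi0 y0.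
set X := kermx _ *m _ in rk.
have sub (z : 'cV[K]_f) : {in A', forall i, (N *m z) i 0 = 0} -> ((row_mask A N *m z)^T <= X)%MS.
  move=> z0; rewrite trmx_mul submxMr //.
  by apply/sub_kermxP; rewrite -trmx_mul (row_mask_mul_eq0P _ _ _).2 // trmx0.
have x1 : (row_mask A N *m x)^T != 0.
  apply: contra xi0 => /eqP/(congr1 trmx); rewrite trmxK trmx0.
  by move=> /row_mask_mul_eq0P ->.
have xX : (X <= (row_mask A N *m x)^T)%MS.
  rewrite -(mxrank_leqif_sup (sub x x0)) eqn_leq mxrankS ?sub //=.
  by apply: leq_trans rk _; rewrite lt0n mxrank_eq0.
have /sub_rVP[t tE] := submx_trans (sub y y0) xX.
exists t => i iA; have /(congr1 trmx) := tE; rewrite linearZ /= !trmxK !row_mask_mul.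
by move=> /matrixP /(_ i 0); rewrite !mxE iA.
Qed.

Lemma mxrank_row_mask_le v f (A' A : {set 'I_v}) (N : 'M[K]_(v, f)) (x : 'cV[K]_f) :
  A' \subset A ->
  (forall y : 'cV[K]_f, {in A', forall i, (N *m y) i 0 = 0} ->
     exists t, {in A, forall i, (N *m y) i 0 = t * (N *m x) i 0}) ->
  (\rank (row_mask A N) <= (\rank (row_mask A' N)).+1)%N.
Proof.
move=> sA H; rewrite -(mxrank_row_mask_gap N sA) -addn1 addnC leq_add2l.
apply: leq_trans (rank_leq_row (row_mask A N *m x)^T); apply: mxrankS.
apply/row_subP => k; rewrite row_mul.
set u := row k _; have [|t tE] := H u^T.
  apply/row_mask_mul_eq0P; rewrite -[LHS]trmxK trmx_mul trmxK.
  by rewrite /u -row_mul mulmx_ker row0 trmx0.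
apply/sub_rVP; exists t; apply/rowP => i; rewrite -[u]trmxK -trmx_mul !row_mask_mul [LHS]mxE [RHS]mxE [X in _ * X]mxE !row_maskE.
by case: ifP => [iA|]; rewrite ?mulr0 // -tE.
Qed.

End Mask.

(** * Matrices with the zero pattern of a slack matrix *)

Lemma exists_min (K : realFieldType) (I : finType) (P : pred I) (g : I -> K) i0 :
  P i0 -> exists2 i, P i & forall j, P j -> g i <= g j.
Proof. by move=> Pi0; case: (arg_minP g Pi0) => i Pi gi; exists i. Qed.

Section SlackPattern.
Variables (K : realFieldType) (v f : nat) (F : 'I_f -> {set 'I_v}).
Implicit Types (A : {set 'I_v}) (N : 'M[K]_(v, f)) (y lam : 'cV[K]_f).

Definition has_pattern N := forall i j, 0 <= N i j /\ (N i j == 0) = (i \in F j).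

(* [A :&: F j] is a maximal proper subface of [A]; different [j] may give the same one. *)
Definition facin A j : bool :=
  ~~ (A \subset F j) &&
  [forall k, (A :&: F j \subset F k) ==> (A \subset F k) || (A :&: F k \subset F j)].

(* For the slack matrix of a polytope and the vertex set [A] of a face, this says that
   the facets of the polytope generate all inequalities valid on that face. *)
Definition conic N A := forall y, {in A, forall i, 0 <= (N *m y) i 0} ->
  exists2 lam : 'cV[K]_f, (forall j, 0 <= lam j 0) & {in A, forall i, (N *m y) i 0 = (N *m lam) i 0}.

(** Among the proper traces [A :&: F l] that contain [A :&: F k], one of largest cardinality is
    maximal for inclusion. *)
Lemma facin_ex A k : ~~ (A \subset F k) -> exists2 l, facin A l & A :&: F k \subset F l.
Proof.
move=> Ak; pose P l := ~~ (A \subset F l) && (A :&: F k \subset F l).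
have Pk : P k by rewrite /P Ak subsetIr.
case: (arg_maxnP (fun l => #|A :&: F l|) Pk) => l /andP[Al kl] lmax.
exists l => //; rewrite /facin Al /=; apply/forallP => k'; apply/implyP => lk'.
have [//|Ak'] := boolP (A \subset F k'); rewrite /=.
have s : A :&: F l \subset A :&: F k' by rewrite subsetI subsetIl lk'.
have := lmax k'; rewrite /P Ak' /=.
rewrite (subset_trans _ lk') ?subsetI ?subsetIl ?kl // => /(_ isT) cle.
by have /eqP <- : A :&: F l == A :&: F k' by [rewrite eqEcard s]; rewrite subsetIr.
Qed.

Lemma facin_max A j k i : facin A j -> A :&: F j \subset F k -> i \in A ->
  i \in F k -> i \notin F j -> A \subset F k.
Proof.
move=> /andP[_ /forallP/(_ k)/implyP H] /H /orP[//|/subsetP s] iA ik.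
by rewrite s // inE iA.
Qed.

Lemma mul_delta N j i : (N *m delta_mx j (0 : 'I_1)) i 0 = N i j.
Proof. by rewrite -colE mxE. Qed.

Lemma mulBdelta N y t j i :
  (N *m (y - t *: delta_mx j (0 : 'I_1))) i 0 = (N *m y) i 0 - t * N i j.
Proof.
rewrite mulmxBr -scalemxAr -(mul_delta N j i).
by rewrite [LHS]mxE [X in _ + X]mxE [X in _ - X]mxE.
Qed.

Section OnePattern.
Variable N : 'M[K]_(v, f).
Hypothesis patN : has_pattern N.

Let N0 i j : 0 <= N i j. Proof. by case: (patN i j). Qed.
Let NF i j : (N i j == 0) = (i \in F j). Proof. by case: (patN i j). Qed.
Let Npos i j : i \notin F j -> 0 < N i j. Proof. by rewrite lt0r N0 NF => ->. Qed.
Let Nz i j : i \in F j -> N i j = 0. Proof. by rewrite -NF => /eqP. Qed.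

Lemma conic_comb_eq0 lam i : (forall j, 0 <= lam j 0) ->
  (N *m lam) i 0 = 0 <-> forall k, 0 < lam k 0 -> i \in F k.
Proof.
move=> lam0; rewrite mxE; split=> [/psumr_eq0P H k lk|H].
  have /eqP := H (fun k _ => mulr_ge0 (N0 i k) (lam0 k)) k isT.
  by rewrite mulf_eq0 (gt_eqF lk) orbF NF.
apply: big1 => k _; have := lam0 k; rewrite le0r => /orP[/eqP->|/H ik].
  by rewrite mulr0.
by rewrite (Nz ik) mul0r.
Qed.

(** Adding a large multiple of column [j] makes a vector that is nonnegative on the subface
    nonnegative on all of [A], and changes nothing on [F j]. *)
Lemma conic_setI A j : conic N A -> conic N (A :&: F j).
Proof.
move=> cA y y0; pose t := \sum_i `|(N *m y) i 0| / N i j.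
have [|lam lam0 lamE] := cA (y + t *: delta_mx j 0).
  move=> i iA; rewrite -[t]opprK scaleNr mulBdelta mulNr opprK.
  have [ij|ij] := boolP (i \in F j).
    by rewrite (Nz ij) mulr0 addr0 y0 // inE iA.
  have : `|(N *m y) i 0| <= t * N i j.
    rewrite -ler_pdivrMr ?Npos // /t (bigD1 i) //= lerDl sumr_ge0 // => k _.
    by rewrite divr_ge0.
  by have := ler_norm (- (N *m y) i 0); rewrite normrN; lra.
exists lam => // i /setIP[iA ij]; rewrite -lamE //.
by rewrite -[t]opprK scaleNr mulBdelta (Nz ij) mulr0 subr0.
Qed.

(** Subtract the multiple [t] of column [j] for which the difference stays nonnegative on [A] and
    has a zero [i0] outside [F j]. Every column of positive weight in a conic expression of the
    difference vanishes on [A :&: F j] and at [i0], hence on [A] by maximality. *)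
Lemma conic_facet_line A j y : conic N A -> facin A j ->
  {in A :&: F j, forall i, (N *m y) i 0 = 0} ->
  exists t, {in A, forall i, (N *m y) i 0 = t * N i j}.
Proof.
move=> cA fj y0; have /andP[/subsetPn[i1 i1A i1j] _] := fj.
have [i0 /andP[i0A i0j] i0min] := @exists_min K _ (fun i => (i \in A) && (i \notin F j))
   (fun i => (N *m y) i 0 / N i j) i1 (introT andP (conj i1A i1j)).
pose t := (N *m y) i0 0 / N i0 j; exists t.
have [|lam lam0 lamE] := cA (y - t *: delta_mx j 0).
  move=> i iA; rewrite mulBdelta; have [ij|ij] := boolP (i \in F j).
    by rewrite (Nz ij) mulr0 subr0 y0 // inE iA.
  by rewrite subr_ge0 -ler_pdivlMr ?Npos // i0min ?iA.
have z i : i \in A -> (N *m y) i 0 - t * N i j = 0 -> forall k, 0 < lam k 0 -> i \in F k.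
  by move=> iA; rewrite -mulBdelta lamE // => /(conic_comb_eq0 _ lam0).
move=> i iA; apply/eqP; rewrite -subr_eq0 -mulBdelta lamE //; apply/eqP.
apply/(conic_comb_eq0 _ lam0) => k lk.
have /subsetP -> // : A \subset F k.
apply: (facin_max fj _ i0A _ i0j); last first.
  by apply: (z i0 i0A _ k lk); rewrite divfK ?subrr // gt_eqF // Npos.
apply/subsetP => i' i'Aj; have /setIP[i'A i'j] := i'Aj.
by apply: (z i') => //; rewrite y0 // (Nz i'j) mulr0 subr0.
Qed.

(** The zeros of $Ny$ in [A] are zeros of every column of positive weight, and such a column can be
    enlarged to a facet [l] of [A]. Subtracting the largest admissible multiple of column [l]
    creates a new zero, so the support shrinks. *)
Lemma conic_facets A y : conic N A -> {in A, forall i, 0 <= (N *m y) i 0} ->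
  exists lam, [/\ forall j, 0 <= lam j 0, forall j, 0 < lam j 0 -> facin A j
    & {in A, forall i, (N *m y) i 0 = (N *m lam) i 0}].
Proof.
move=> cA; have [n] := ubnP #|[set i in A | (N *m y) i 0 != 0]|.
elim: n y => // n IHn y ltn y0.
have [/eqP Z0|/set0Pn[i1]] := boolP ([set i in A | (N *m y) i 0 != 0] == set0).
  exists 0; split=> [j|j|i iA]; rewrite ?mulmx0; do ?by rewrite mxE ?ltxx.
  rewrite [RHS]mxE; have : i \notin [set i in A | (N *m y) i 0 != 0] by rewrite Z0 inE.
  by rewrite inE iA /= negbK => /eqP.
rewrite inE => /andP[i1A yi1].
have [lam lam0 lamE] := cA y y0.
have [k lk i1k] : exists2 k, 0 < lam k 0 & i1 \notin F k.
  have : ~~ [forall k, (0 < lam k 0) ==> (i1 \in F k)].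
    apply: contra yi1 => /forallP H; rewrite lamE //; apply/eqP/conic_comb_eq0 => // k.
    exact/implyP.
  by rewrite negb_forall => /existsP[k]; rewrite negb_imply => /andP[]; exists k.
have yF i : i \in A -> (N *m y) i 0 = 0 -> i \in A :&: F k.
  by move=> iA; rewrite lamE // inE iA => /conic_comb_eq0 ->.
have [|l fl kl] := @facin_ex A k; first by apply/subsetPn; exists i1.
have /andP[/subsetPn[i2 i2A i2l] _] := fl.
have [i0 /andP[i0A i0l] i0min] := @exists_min K _ (fun i => (i \in A) && (i \notin F l))
   (fun i => (N *m y) i 0 / N i l) i2 (introT andP (conj i2A i2l)).
pose t := (N *m y) i0 0 / N i0 l.
have t0 : 0 <= t by rewrite divr_ge0 ?y0.
pose y' := y - t *: delta_mx l 0.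
have [||mu [mu0 muF muE]] := IHn y'.
- rewrite -ltnS (leq_trans _ ltn) // ltnS; apply/proper_card/properP; split.
    apply/subsetP => i; rewrite !inE => /andP[iA]; rewrite iA mulBdelta.
    apply: contraNneq => yi; have /(subsetP kl) il := yF i iA yi.
    by rewrite yi (Nz il) mulr0 subr0.
  exists i0; rewrite inE i0A /=.
    by apply: contra i0l => /eqP yi; apply: (subsetP kl); exact: yF.
  by rewrite mulBdelta /t divfK ?subrr ?eqxx // gt_eqF // Npos.
- move=> i iA; rewrite mulBdelta; have [il|il] := boolP (i \in F l).
    by rewrite (Nz il) mulr0 subr0 y0.
  by rewrite subr_ge0 -ler_pdivlMr ?Npos // i0min ?iA.
exists (mu + t *: delta_mx l 0); split=> [j|j|i iA].
- by rewrite !mxE addr_ge0 // mulr_ge0 ?ler0n.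
- rewrite !mxE eqxx andbT; have [->//|] := eqVneq j l.
  by rewrite mulr0 addr0 => _ /muF.
- rewrite -[t]opprK scaleNr mulBdelta mulNr opprK -muE // mulBdelta; lra.
Qed.

(** Expand column [k] on [A] into facet columns of [A]. One of positive weight that is nonzero at a
    point of [A :&: F j] outside [F k] vanishes on [A :&: F j :&: F k], so by maximality it cuts out
    the same subface. *)
Lemma conic_diamond A j k : conic N A -> facin A j -> facin (A :&: F j) k ->
  exists l, [/\ facin A l, facin (A :&: F j) l & A :&: F j :&: F l = A :&: F j :&: F k].
Proof.
move=> cA fj fk; have /andP[/subsetPn[i iAj ik] _] := fk.
have /setIP[iA ij] := iAj.
have [|lam [lam0 lamF lamE]] := @conic_facets A (delta_mx k 0) cA.
  by move=> i' _; rewrite mul_delta.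
have kz i' : i' \in A -> i' \in F k -> forall l, 0 < lam l 0 -> i' \in F l.
  move=> i'A i'k; apply/conic_comb_eq0 => //; by rewrite -lamE // mul_delta Nz.
have [l ll il] : exists2 l, 0 < lam l 0 & i \notin F l.
  have : ~~ [forall k, (0 < lam k 0) ==> (i \in F k)].
    apply: contra ik => /forallP H; rewrite -NF -(mul_delta N k i) lamE //.
    by apply/eqP/conic_comb_eq0 => // k'; exact/implyP.
  by rewrite negb_forall => /existsP[l]; rewrite negb_imply => /andP[]; exists l.
have kl : A :&: F j :&: F k \subset F l.
  by apply/subsetP => i' /setIP[/setIP[i'A _] i'k]; exact: kz ll.
have lk : A :&: F j :&: F l = A :&: F j :&: F k.
  apply/eqP; rewrite eqEsubset; apply/andP; split; last by rewrite subsetI subsetIl kl.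
  rewrite subsetI subsetIl /=.
  case/andP: fk => _ /forallP/(_ l)/implyP/(_ kl)/orP[/subsetP/(_ i iAj)|//].
  by rewrite (negPf il).
exists l; split=> //; first exact: lamF.
rewrite /facin; apply/andP; split; first by apply/subsetPn; exists i.
apply/forallP => k'; rewrite lk; case/andP: fk => _ /forallP/(_ k')/implyP H.
apply/implyP => /H /orP[->//|s]; apply/orP; right.
by apply: subset_trans kl; rewrite subsetI subsetIl s.
Qed.

End OnePattern.
End SlackPattern.

(** * Transfer of conicity along a zero pattern *)

Section Transfer.
Variables (K : realFieldType) (v f : nat) (F : 'I_f -> {set 'I_v}).
Variables S M : 'M[K]_(v, f).
Hypotheses (patS : has_pattern F S) (patM : has_pattern F M).
Implicit Types (A : {set 'I_v}) (y lam : 'cV[K]_f).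

Lemma mxrank_facet_le A j : conic S A -> facin F A j ->
  (\rank (row_mask A S) <= (\rank (row_mask (A :&: F j) S)).+1)%N.
Proof.
move=> cA fj; apply: (@mxrank_row_mask_le _ _ _ _ _ _ (delta_mx j 0)); first exact: subsetIl.
move=> y y0; have [t tE] := conic_facet_line patS cA fj y0.
by exists t => i iA; rewrite mul_delta tE.
Qed.

Lemma mxrank_facet_lt A j : facin F A j ->
  (\rank (row_mask (A :&: F j) M) < \rank (row_mask A M))%N.
Proof.
case/andP=> /subsetPn[i iA ij] _.
apply: (@mxrank_row_mask_lt _ _ _ _ _ _ (delta_mx j 0) i) => //; first exact: subsetIl.
  by move=> k /setIP[_ kj]; apply/eqP; rewrite mul_delta (patM k j).2.
by rewrite mul_delta (patM i j).2.
Qed.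

(* A descending chain of faces forces the rank of [S] to drop by at most one and
   that of [M] by at least one at each step. *)
Lemma mxrank_pattern_le A : conic S A -> (\rank (row_mask A S) <= \rank (row_mask A M))%N.
Proof.
have [n] := ubnP #|A|; elim: n A => // n IHn A ltn cA.
have [/existsP[k /facin_ex[j fj _]]|H] := boolP [exists k, ~~ (A \subset F k)].
  apply: leq_trans (mxrank_facet_le cA fj) _.
  apply: leq_trans (mxrank_facet_lt fj); rewrite ltnS.
  apply: IHn; last exact: conic_setI.
  rewrite -ltnS (leq_trans _ ltn) // ltnS; apply/proper_card.
  rewrite properE subsetIl; case/andP: fj => fj _.
  by apply: contra fj => s; apply: subset_trans s _; exact: subsetIr.
suff -> : row_mask A S = 0 by rewrite mxrank0.
apply/matrixP => i k; rewrite row_maskE mxE; case: ifP => // iA; apply/eqP.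
move: H; rewrite negb_exists => /forallP/(_ k); rewrite negbK => /subsetP/(_ i iA).
by rewrite (patS i k).2.
Qed.

(** By [mxrank_pattern_le] the ranks of [S] and [M] on [A] then agree. This passes to facets of [A]:
    the rank of [S] drops by at most one and that of [M] by at least one. *)
Definition flagged A :=
  conic S A /\ (\rank (row_mask A M) <= \rank (row_mask A S))%N.

Lemma flagged_setI A j : flagged A -> facin F A j -> flagged (A :&: F j).
Proof.
move=> [cA rA] fj; split; first exact: conic_setI.
by have := mxrank_facet_le cA fj; have := mxrank_facet_lt fj; lia.
Qed.

Lemma flagged_facet_line A j y : flagged A -> facin F A j ->
  {in A :&: F j, forall i, (M *m y) i 0 = 0} ->
  exists t, {in A, forall i, (M *m y) i 0 = t * M i j}.
Proof.
move=> gA fj y0; have /andP[/subsetPn[i iA ij] _] := fj.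
have [cA' rA'] := flagged_setI gA fj; have [cA rA] := gA.
have [t tE] : exists t, {in A, forall i, (M *m y) i 0 = t * (M *m delta_mx j (0 : 'I_1)) i 0}.
  have rk : (\rank (row_mask A M) <= (\rank (row_mask (A :&: F j) M)).+1)%N.
    by have := mxrank_facet_le cA fj; have := mxrank_pattern_le cA'; lia.
  apply: (mxrank_row_mask_prop (subsetIl _ _) rk _ iA) y0.
  - by move=> k /setIP[_ kj]; apply/eqP; rewrite mul_delta (patM k j).2.
  - by rewrite mul_delta (patM i j).2.
by exists t => k kA; rewrite tE // mul_delta.
Qed.

(* A Farkas certificate [z] against conicity is shifted by a multiple of the all-ones
   vector until it vanishes on some facet column [l]; conicity on the facet cut out by
   [l], together with the diamond property, then contradicts it. *)
Lemma flagged_conic_facets A y : flagged A -> {in A, forall i, 0 <= (M *m y) i 0} ->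
  exists lam, [/\ forall j, 0 <= lam j 0, forall j, 0 < lam j 0 -> facin F A j
    & {in A, forall i, (M *m y) i 0 = (M *m lam) i 0}].
Proof.
have [n] := ubnP #|A|; elim: n A y => // n IHn A y ltn gA y0.
pose B : 'M[K]_(v, f) := \matrix_(i, l) if (i \in A) && facin F A l then M i l else 0.
have [[lam [lam0 cE]]|[z [z0 zc]]] := farkas B (row_mask A M *m y).
  exists (\col_l if facin F A l then lam l 0 else 0); split=> [j|j|i iA].
  - by rewrite mxE; case: ifP.
  - by rewrite mxE; case: ifP; rewrite ?ltxx.
  - have /matrixP/(_ i 0) := cE; rewrite row_mask_mul row_maskE iA => ->.
    rewrite !mxE; apply: eq_bigr => l _; rewrite !mxE iA /=.
    by case: ifP; rewrite ?mul0r ?mulr0.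
exfalso.
pose w l := \sum_(i in A) z 0 i * M i l.
pose o l := \sum_(i in A) M i l.
have w0 l : facin F A l -> 0 <= w l.
  move=> fl; suff -> : w l = (z *m B) 0 l by [].
  rewrite mxE /w big_mkcond; apply: eq_bigr => i _.
  by rewrite mxE fl andbT; case: ifP; rewrite ?mulr0.
have o0 l : facin F A l -> 0 < o l.
  case/andP=> /subsetPn[i iA il] _; rewrite /o (bigD1 i) //=.
  rewrite ltr_wpDr ?sumr_ge0 // => [k _|]; first by case: (patM k l).
  by rewrite lt0r (patM i l).2 il (patM i l).1.
have zcE : \sum_(i in A) z 0 i * (M *m y) i 0 < 0.
  suff -> : \sum_(i in A) z 0 i * (M *m y) i 0 = (z *m (row_mask A M *m y)) 0 0 by [].
  rewrite [RHS]mxE big_mkcond; apply: eq_bigr => i _.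
  by rewrite row_mask_mul row_maskE; case: ifP; rewrite ?mulr0.
have [l1 fl1] : exists l, facin F A l.
  have [/existsP[k /facin_ex[j fj _]]|H] := boolP [exists k, ~~ (A \subset F k)].
    by exists j.
  move: zcE; rewrite big1 ?ltxx // => i iA; rewrite mxE big1 ?mulr0 // => k _.
  move: H; rewrite negb_exists => /forallP/(_ k); rewrite negbK => /subsetP/(_ i iA).
  by rewrite -(patM i k).2 => /eqP->; rewrite mul0r.
have [l fl lmin] := @exists_min K _ (facin F A) (fun l => w l / o l) l1 fl1.
(* [rho] is the largest multiple of the all-ones vector that can be subtracted from [z] keeping it
   nonnegative on the facet columns. The shifted functional [psi] vanishes on column [l] and is
   still negative on $My$, since $My\ge 0$ on [A]. *)
pose rho := w l / o l.
have rho0 : 0 <= rho by rewrite divr_ge0 ?w0 // ltW ?o0.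
pose psi (u : 'I_v -> K) := \sum_(i in A) (z 0 i - rho) * u i.
have psiE u : psi u = \sum_(i in A) z 0 i * u i - rho * \sum_(i in A) u i.
  by rewrite mulr_sumr -sumrB; apply: eq_bigr => i _; rewrite mulrBl.
have psi0 l' : facin F A l' -> 0 <= psi (fun i => M i l').
  by move=> fl'; rewrite psiE subr_ge0 -ler_pdivlMr ?o0 // lmin.
have psil : psi (fun i => M i l) = 0.
  by rewrite psiE -/(w l) -/(o l) divfK ?subrr // gt_eqF ?o0.
have psiy : psi (fun i => (M *m y) i 0) < 0.
  rewrite psiE subr_lt0 (lt_le_trans zcE) // mulr_ge0 // sumr_ge0 //.
have gA' := flagged_setI gA fl.
have [|//|i /setIP[iA _]|lam [lam0 lamF lamE]] := IHn (A :&: F l) y; rewrite ?y0 //.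
  rewrite -ltnS (leq_trans _ ltn) // ltnS; apply/proper_card.
  rewrite properE subsetIl; case/andP: fl => fl _.
  by apply: contra fl => s; apply: subset_trans s _; exact: subsetIr.
(* By the diamond property each facet of [A :&: F l] is also cut out by a facet [lt.1] of [A], and
   the two columns are proportional there with factor [lt.2]. Other indices get a dummy value. *)
have /fin_all_exists[lt ltE] (k : 'I_f) : exists lt : 'I_f * K, facin F (A :&: F l) k ->
    [/\ facin F A lt.1, 0 <= lt.2 & {in A :&: F l, forall i, M i k = lt.2 * M i lt.1}].
  have [fk|] := boolP (facin F (A :&: F l) k); last by exists (k, 0).
  have [l' [fl' fl'2 e]] := conic_diamond patS gA.1 fl fk.
  have [t tE] : exists t, {in A :&: F l, forall i, (M *m delta_mx k (0 : 'I_1)) i 0 = t * M i l'}.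
    apply: flagged_facet_line => // i; rewrite e => /setIP[_ ik].
    by apply/eqP; rewrite mul_delta (patM i k).2.
  exists (l', t) => _; split=> //= [|i iAl]; last by rewrite -tE // mul_delta.
  case/andP: fk => /subsetPn[i iAl ik] _; have := tE i iAl; rewrite mul_delta => e1.
  rewrite leNgt; apply/negP => t0; have : 0 < M i k.
    by rewrite lt0r (patM i k).2 ik (patM i k).1.
  by rewrite e1 ltNge nmulr_rle0 // (patM i l').1.
(* This remainder vanishes on [A :&: F l], so on [A] it is a multiple of column [l], which [psi]
   kills. Hence [psi] of $My$ is a nonnegative combination of its values on facet columns. *)
pose y2 := y - \sum_k (lam k 0 * (lt k).2) *: delta_mx (lt k).1 (0 : 'I_1).
have y2E i : (M *m y2) i 0 = (M *m y) i 0 - \sum_k lam k 0 * ((lt k).2 * M i (lt k).1).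
  rewrite mulmxBr mulmx_sumr mxE [X in _ + X]mxE summxE; congr (_ - _).
  by apply: eq_bigr => k _; rewrite -scalemxAr mxE mul_delta mulrA.
have [|mu muE] := @flagged_facet_line A l y2 gA fl.
  move=> i iAl; rewrite y2E lamE // mxE -sumrB big1 // => k _.
  have := lam0 k; rewrite le0r => /orP[/eqP->|lk]; first by rewrite mulr0 mul0r subr0.
  by have [_ _ <- //] := ltE k (lamF k lk); rewrite mulrC subrr.
suff : 0 <= psi (fun i => (M *m y) i 0) by rewrite leNgt psiy.
have -> : psi (fun i => (M *m y) i 0) = \sum_k lam k 0 * (lt k).2 * psi (fun i => M i (lt k).1)
             + mu * psi (fun i => M i l).
  rewrite /psi mulr_sumr; under [X in _ = X + _]eq_bigr => k _ do rewrite mulr_sumr.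
  rewrite exchange_big -big_split /=; apply: eq_bigr => i iA.
  have := muE i iA; rewrite y2E => /eqP; rewrite subr_eq => /eqP->.
  rewrite mulrDr [LHS]addrC mulr_sumr; congr (_ + _); last by ring.
  by apply: eq_bigr => k _; ring.
rewrite psil mulr0 addr0 sumr_ge0 // => k _.
have [->|lkn] := eqVneq (lam k 0) 0; first by rewrite !mul0r.
have lk : 0 < lam k 0 by rewrite lt0r lkn lam0.
have [fk tk _] := ltE k (lamF k lk); by rewrite !mulr_ge0 ?psi0.
Qed.

End Transfer.

Theorem conic_transfer (K : realFieldType) (v f : nat) (F : 'I_f -> {set 'I_v})
    (S M : 'M[K]_(v, f)) :
  has_pattern F S -> has_pattern F M -> conic S setT -> (\rank M <= \rank S)%N ->
  conic M setT.
Proof.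
move=> pS pM cS rk y y0.
have [|lam [lam0 _ lamE]] := flagged_conic_facets pS pM _ y0; last by exists lam.
by split=> //; rewrite !row_maskT.
Qed.

(** * Homogenized polytopes and their inequalities *)

Lemma exists_coker (K : fieldType) (k m : nat) (X : 'M[K]_(k, m)) :
  (\rank X < m)%N -> exists2 y : 'cV[K]_m, y != 0 & X *m y = 0.
Proof.
move=> rX; have : cokermx X != 0 by rewrite -mxrank_eq0 mxrank_coker subn_eq0 -ltnNge.
case/matrix0Pn => i [j nz]; exists (col j (cokermx X)).
  by apply: contra nz => /eqP/matrixP/(_ i 0); rewrite !mxE => ->.
by rewrite colE mulmxA mulmx_coker mul0mx.
Qed.

Lemma exists_rowsub_free (K : fieldType) (m n k : nat) (X : 'M[K]_(m, n)) :
  (k <= \rank X)%N -> exists2 h : 'I_k -> 'I_m, injective h & row_free (rowsub h X).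
Proof.
move=> rX; pose h (i : 'I_k) := maxrankfun X (widen_ord rX i).
exists h; first by move=> i j /maxrankfun_inj/(congr1 val)/= /val_inj.
have /row_freeP[B BE] : row_free (rowsub (maxrankfun X) X) by exact: maxrowsub_free.
apply/row_freeP; exists (B *m (\matrix_(i, j) (i == widen_ord rX j)%:R)).
have -> : rowsub h X = rowsub (widen_ord rX) (rowsub (maxrankfun X) X).
  by apply/matrixP => i j; rewrite !mxE.
rewrite mulmxA mul_rowsub_mx BE; apply/matrixP => i j.
rewrite !mxE (bigD1 (widen_ord rX i)) //= big1 => [|l ln]; last first.
  by rewrite !mxE eq_sym (negPf ln) mul0r.
by rewrite !mxE eqxx mul1r addr0 -!val_eqE.
Qed.

Definition zeros (K : realFieldType) (v m : nat) (H : 'M[K]_(v, m)) (y : 'cV[K]_m)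
  : {set 'I_v} := [set i | (H *m y) i 0 == 0].

Section Rotate.
Variables (K : realFieldType) (v m : nat) (H : 'M[K]_(v, m)).
Hypothesis fullH : \rank H = m.

Lemma full_mulmx_inj (y1 y2 : 'cV[K]_m) : H *m y1 = H *m y2 -> y1 = y2.
Proof. by apply: row_full_inj; rewrite /row_full fullH. Qed.

Lemma full_mul_neq0 (y : 'cV[K]_m) : y != 0 -> exists i, (H *m y) i 0 != 0.
Proof.
move=> y0; have : H *m y != 0.
  by apply: contra y0 => /eqP e; apply/eqP/full_mulmx_inj; rewrite mulmx0.
by case/matrix0Pn => i [j]; rewrite ord1; exists i.
Qed.

(** The rows in [T] have corank at most one, so the vectors that vanish on them form at most a
    line. *)
Lemma corank1_line (T : {set 'I_v}) (x y : 'cV[K]_m) :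
  (m <= (\rank (row_mask T H)).+1)%N -> x != 0 ->
  {in T, forall i, (H *m x) i 0 = 0} -> {in T, forall i, (H *m y) i 0 = 0} ->
  exists t, y = t *: x.
Proof.
move=> rT x0 xT yT; have [i0 xi0] := full_mul_neq0 x0.
have [|t tE] := mxrank_row_mask_prop (subsetT T) _ xT (in_setT i0) xi0 yT.
  by rewrite row_maskT fullH.
exists t; apply: full_mulmx_inj; rewrite -scalemxAr.
by apply/colP => i; rewrite tE ?inE // [RHS]mxE.
Qed.

(* Rotate a valid inequality about its tight points, keeping its value at [z], until
   it becomes tight at a new point: this raises the rank of the tight set. *)
Lemma rotate_to_facet (z : 'rV[K]_m) (y : 'cV[K]_m) :
  (forall i, 0 <= (H *m y) i 0) -> (z *m y) 0 0 < 0 ->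
  exists y', [/\ forall i, 0 <= (H *m y') i 0, (z *m y') 0 0 < 0 &
                 (m <= (\rank (row_mask (zeros H y') H)).+1)%N].
Proof.
have [n] := ubnP (m - \rank (row_mask (zeros H y) H)).
elim: n y => // n IHn y ltn y0 zy.
have [le|gt] := leqP m (\rank (row_mask (zeros H y) H)).+1; first by exists y.
(* The tight rows have corank at least two, which leaves a direction vanishing on them and on [z];
   its sign is then chosen so that it is negative somewhere. *)
have [|y1 y1n0] := @exists_coker _ _ _ (col_mx (row_mask (zeros H y) H) z).
  rewrite -addsmxE; apply: leq_ltn_trans gt.
  apply: leq_trans (mxrank_adds_leqif _ _) _; rewrite -[leqRHS]addn1 leq_add2l.
  exact: rank_leq_row.
rewrite mul_col_mx => /eqP; rewrite col_mx_eq0 => /andP[/eqP/row_mask_mul_eq0P Ty1 /eqP zy1].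
have [y2 [Ty2 zy2 [i2 i2neg]]] : exists y2 : 'cV[K]_m,
    [/\ {in zeros H y, forall i, (H *m y2) i 0 = 0}, z *m y2 = 0 & exists i, (H *m y2) i 0 < 0].
  have [i nz] := full_mul_neq0 y1n0.
  have [neg|pos] := ltrP ((H *m y1) i 0) 0; first by exists y1; split=> //; exists i.
  exists (- y1); split=> [k kT||].
  - by rewrite mulmxN mxE Ty1 ?oppr0.
  - by rewrite mulmxN zy1 oppr0.
  - by exists i; rewrite mulmxN mxE oppr_lt0 lt0r nz.
have [i0 i0neg i0min] := @exists_min K _ (fun i => (H *m y2) i 0 < 0)
   (fun i => (H *m y) i 0 / - (H *m y2) i 0) i2 i2neg.
pose t := (H *m y) i0 0 / - (H *m y2) i0 0.
have t0 : 0 <= t by rewrite divr_ge0 // oppr_ge0 ltW.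
have HE i : (H *m (y + t *: y2)) i 0 = (H *m y) i 0 + t * (H *m y2) i 0.
  by rewrite mulmxDr -scalemxAr [LHS]mxE [X in _ + X]mxE.
have sT : zeros H y \subset zeros H (y + t *: y2).
  apply/subsetP => i iT; rewrite inE HE Ty2 // mulr0 addr0.
  by move: iT; rewrite inE.
have i0T : i0 \in zeros H (y + t *: y2).
  by rewrite inE HE /t invrN mulrN mulNr divfK ?subrr // lt_eqF.
have rlt := mxrank_row_mask_lt sT Ty2 i0T (ltr0_neq0 i0neg).
apply: (IHn (y + t *: y2)).
- by move: rlt ltn gt; lia.
- move=> i; rewrite HE; have [neg|pos] := ltrP ((H *m y2) i 0) 0.
    have := i0min i neg; rewrite -/t ler_pdivlMr ?oppr_gt0 //; lra.
  by rewrite addr_ge0 // mulr_ge0.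
- by rewrite mulmxDr -scalemxAr zy2 scaler0 addr0.
Qed.

End Rotate.

Section Geometry.
Variable d : nat.
Implicit Types (v : nat).

Definition hmat v (p : 'I_v -> 'rV[R]_d) : 'M[R]_(v, d + 1) :=
  \matrix_(i < v) row_mx (p i) (1 : 'rV[R]_1).

(** The inequality $\langle a,x\rangle\le b$ as a linear functional on homogeneous coordinates; its
    value at a point is the slack $b-\langle a,x\rangle$. *)
Definition ycol (a : 'rV[R]_d) (b : R) : 'cV[R]_(d + 1) :=
  col_mx (- a^T) b%:M.

Lemma row_ycol x a b : (row_mx x (1 : 'rV[R]_1) *m ycol a b) 0 0 = b - dotp a x.
Proof.
rewrite mul_row_col mulmxN mul1mx mxE [X in X + _]mxE [X in _ + X]mxE eqxx mulr1n addrC.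
by congr (_ - _); rewrite /dotp !mxE; apply: eq_bigr => k _; rewrite !mxE mulrC.
Qed.

Lemma dot0p (x : 'rV[R]_d) : dotp 0 x = 0.
Proof. by rewrite /dotp mul0mx mxE. Qed.

Lemma row_hmat v (p : 'I_v -> 'rV[R]_d) i : row i (hmat p) = row_mx (p i) 1.
Proof. by apply/rowP => k; rewrite !mxE. Qed.

Lemma hmat_ycol v (p : 'I_v -> 'rV[R]_d) a b i :
  (hmat p *m ycol a b) i 0 = b - dotp a (p i).
Proof. by rewrite -row_ycol -row_hmat -row_mul [RHS]mxE. Qed.

Lemma ycol_ex (y : 'cV[R]_(d + 1)) : exists a b, y = ycol a b.
Proof.
exists (- (usubmx y)^T), (dsubmx y 0 0); rewrite /ycol linearN /= trmxK opprK.
by rewrite -[LHS]vsubmxK [dsubmx y in LHS]mx11_scalar.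
Qed.

Lemma mul_hmat v (p : 'I_v -> 'rV[R]_d) (lam : 'rV[R]_v) :
  lam *m hmat p = row_mx (\sum_k lam 0 k *: p k) (\sum_k lam 0 k)%:M.
Proof.
rewrite mulmx_sum_row; under eq_bigr do rewrite row_hmat scale_row_mx.
rewrite -[LHS]hsubmxK; congr row_mx; rewrite linear_sum /=.
  by apply: eq_bigr => k _; rewrite row_mxKl.
rewrite raddf_sum /=; apply: eq_bigr => k _; rewrite row_mxKr.
by apply/rowP => i; rewrite !mxE ord1 eqxx mulr1.
Qed.

Lemma in_conv_row v (p : 'I_v -> 'rV[R]_d) x :
  in_conv p x <-> exists2 lam : 'rV[R]_v, (forall k, 0 <= lam 0 k) &
                  row_mx x 1 = lam *m hmat p.
Proof.
split=> [[lam [lam0 _ s1 ->]]|[lam lam0]].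
  exists (\row_k lam k) => [k|]; first by rewrite mxE.
  rewrite mul_hmat; under [in RHS]eq_bigr do rewrite mxE.
  by under [X in X%:M]eq_bigr do rewrite mxE; rewrite s1.
rewrite mul_hmat => /eq_row_mx[-> /matrixP/(_ 0 0)]; rewrite !mxE !mulr1n => s1.
by exists (lam 0); split.
Qed.

Lemma in_conv_vertex v (p : 'I_v -> 'rV[R]_d) i : in_conv p (p i).
Proof.
apply/in_conv_row; exists (delta_mx 0 i) => [k|].
  by rewrite mxE eqxx /=; case: eqP.
by rewrite -row_hmat rowE.
Qed.

Lemma valid_ineqP v (p : 'I_v -> 'rV[R]_d) a b :
  valid_ineq p a b <-> forall i, 0 <= (hmat p *m ycol a b) i 0.
Proof.
split=> [V i|V x /in_conv_row[lam lam0 xE]].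
  by rewrite hmat_ycol subr_ge0; apply/V/in_conv_vertex.
rewrite -subr_ge0 -row_ycol xE -mulmxA mxE sumr_ge0 // => k _.
by rewrite mulr_ge0.
Qed.

Lemma is_faceP v (p : 'I_v -> 'rV[R]_d) S :
  is_face p S <-> exists2 y, (forall i, 0 <= (hmat p *m y) i 0) & S = zeros (hmat p) y.
Proof.
split=> [[a [b [/valid_ineqP V ->]]]|[y V ->]].
  exists (ycol a b) => //; apply/setP => i; rewrite !inE hmat_ycol subr_eq0.
  by rewrite eq_sym.
have [a [b yE]] := ycol_ex y; exists a, b; split; first by apply/valid_ineqP; rewrite -yE.
by apply/setP => i; rewrite !inE yE hmat_ycol subr_eq0 eq_sym.
Qed.

Lemma full_dim_rank v (p : 'I_v -> 'rV[R]_d) : full_dim p -> \rank (hmat p) = (d + 1)%N.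
Proof.
case=> r [rc fr]; apply/eqP; rewrite eqn_leq rank_leq_col [leqLHS]addn1.
have /fin_all_exists2[lam lam0 lamE] k := (in_conv_row p (r k)).1 (rc k).
move: fr; rewrite /aff_indep /row_free => /eqP <-.
have -> : \matrix_(i < d.+1) row_mx (r i) 1 = (\matrix_i lam i) *m hmat p.
  by apply/row_matrixP => i; rewrite row_mul !rowK.
exact: mxrankM_maxr.
Qed.

(** Each of the [d] affinely independent points of the facet is a convex combination of the [p k]
    with weight zero off the tight ones, so the tight rows already have rank at least [d]. *)
Lemma facet_ineq_rank v (p : 'I_v -> 'rV[R]_d) a b : facet_ineq p a b ->
  (d + 1 <= (\rank (row_mask (zeros (hmat p) (ycol a b)) (hmat p))).+1)%N.
Proof.
case=> _ /valid_ineqP V [q [qH fr]]; rewrite [leqLHS]addn1 ltnS.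
have /fin_all_exists2[lam lam0 lamE] k := (in_conv_row p (q k)).1 (qH k).1.
move: fr; rewrite /aff_indep /row_free => /eqP {1}<-.
set T := zeros _ _.
have -> : \matrix_(i < d) row_mx (q i) 1 = (\matrix_i lam i) *m row_mask T (hmat p).
  apply/row_matrixP => i; rewrite row_mul !rowK lamE; apply/rowP => k.
  rewrite !mxE; apply: eq_bigr => l _; rewrite [in RHS]mxE; case: ifP => // lT.
  have : (row_mx (q i) 1 *m ycol a b) 0 0 = 0 by rewrite row_ycol (qH i).2 subrr.
  rewrite lamE -mulmxA mxE => /psumr_eq0P H.
  have /eqP := H (fun j _ => mulr_ge0 (lam0 i j) (V j)) l isT.
  rewrite mulf_eq0 => /orP[/eqP->|]; first by rewrite !mul0r.
  by move: lT; rewrite inE => ->.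
exact: mxrankM_maxr.
Qed.

Lemma rank_facet_ineq v (p : 'I_v -> 'rV[R]_d) a b : a != 0 ->
  (forall i, 0 <= (hmat p *m ycol a b) i 0) ->
  (d + 1 <= (\rank (row_mask (zeros (hmat p) (ycol a b)) (hmat p))).+1)%N ->
  facet_ineq p a b.
Proof.
move=> a0 V; rewrite [leqLHS]addn1 ltnS; set T := zeros _ _; set X := row_mask _ _ => rX.
split=> //; first exact/valid_ineqP.
have [h _ fr] := exists_rowsub_free rX.
have hT k : h k \in T.
  have [//|hk] := boolP (h k \in T); have : row k (rowsub h X) = 0.
    by apply/rowP => l; rewrite !mxE (negPf hk).
  move/row_freeP: fr => [B BE] r0; have : row k (rowsub h X *m B) = 0.
    by rewrite row_mul r0 mul0mx.
  by move=> /rowP/(_ k); rewrite BE !mxE eqxx => /eqP; rewrite oner_eq0.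
exists (fun k => p (h k)); split=> [k|].
  split; first exact: in_conv_vertex.
  by have := hT k; rewrite inE hmat_ycol subr_eq0 => /eqP.
rewrite /aff_indep; congr row_free: fr; apply/matrixP => i j.
by rewrite !mxE hT.
Qed.

End Geometry.

(** * Vertices, facets and the slack matrix *)

(** The intersection of the [F k] of positive weight. It does not involve the entries of a matrix,
    so it lets faces be compared between conic matrices of equal pattern. *)
Definition common_zeros (K : realFieldType) (v f : nat) (F : 'I_f -> {set 'I_v})
  (lam : 'cV[K]_f) : {set 'I_v} := [set i | [forall k, (0 < lam k 0) ==> (i \in F k)]].

Lemma zeros_conic (K : realFieldType) (v f : nat) (F : 'I_f -> {set 'I_v})
    (N : 'M[K]_(v, f)) (lam : 'cV[K]_f) : has_pattern F N ->
  (forall j, 0 <= lam j 0) -> zeros N lam = common_zeros F lam.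
Proof.
move=> pN lam0; apply/setP => i; rewrite !inE; apply/eqP/forallP => H.
  by move=> k; apply/implyP; move: k; apply/(conic_comb_eq0 pN).
by apply/(conic_comb_eq0 pN) => // k; exact/implyP.
Qed.

Lemma conic_zerosP (K : realFieldType) (v f : nat) (F : 'I_f -> {set 'I_v})
    (N : 'M[K]_(v, f)) A : has_pattern F N -> conic N setT ->
  (exists2 y, (forall i, 0 <= (N *m y) i 0) & A = zeros N y) <->
  (exists2 lam : 'cV[K]_f, (forall j, 0 <= lam j 0) & A = common_zeros F lam).
Proof.
move=> pN cN; split=> [[y y0 ->]|[lam lam0 ->]].
  have [|lam lam0 lamE] := cN y; first by move=> i _.
  exists lam => //; rewrite -(zeros_conic pN lam0).
  by apply/setP => i; rewrite !inE lamE ?inE.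
exists lam; last by rewrite (zeros_conic pN).
by move=> i; rewrite mxE sumr_ge0 // => k _; rewrite mulr_ge0 // (pN i k).1.
Qed.

(** As [X] has a right inverse, the vectors [hmat p *m y] form exactly the column space of
    [hmat p *m X], and the faces are read off from [F] alone. *)
Lemma is_face_conic (d v f : nat) (p : 'I_v -> 'rV[R]_d) (X : 'M[R]_(d + 1, f))
    (F : 'I_f -> {set 'I_v}) A :
  row_free X -> has_pattern F (hmat p *m X) -> conic (hmat p *m X) setT ->
  is_face p A <->
  exists2 lam : 'cV[R]_f, (forall j, 0 <= lam j 0) & A = common_zeros F lam.
Proof.
move=> /row_freeP[Y XY] pN cN; apply: iff_trans (conic_zerosP A pN cN).
split=> [/is_faceP[y y0 ->]|[y y0 ->]].
  have e : hmat p *m X *m (Y *m y) = hmat p *m y by rewrite -!mulmxA (mulmxA X) XY mul1mx.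
  exists (Y *m y); first by rewrite e.
  by rewrite /zeros e.
by apply/is_faceP; exists (X *m y); rewrite /zeros mulmxA.
Qed.

Section Vertices.
Variables (d v : nat) (p : 'I_v -> 'rV[R]_d).
Hypothesis vp : vertex_family p.

(** Farkas for the homogenized points: a nonnegative combination of the others equal to that of
    [p i] would be convex, the last coordinates being 1. A separating functional is shifted by a
    constant to vanish at [p i]. *)
Lemma vertex_exposed i : is_face p [set i].
Proof.
have [[lam [lam0 lamE]]|[z [z0 zc]]] :=
  farkas (row_mask [set~ i] (hmat p))^T (row i (hmat p))^T.
  exfalso; apply: (vp (i := i)).
  pose mu : 'rV[R]_v := \row_k if k == i then 0 else lam k 0.
  have : row_mx (p i) 1 = mu *m hmat p.
    rewrite -row_hmat -[LHS]trmxK lamE trmx_mul trmxK; apply/rowP => l.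
    rewrite [LHS]mxE [RHS]mxE; apply: eq_bigr => k _; rewrite !row_maskE !inE.
    by rewrite [X in X * _]mxE [X in _ = X * _]mxE; case: eqP; rewrite ?mulr0 ?mul0r.
  rewrite mul_hmat => /eq_row_mx[e /matrixP/(_ 0 0)]; rewrite !mxE !mulr1n => s1.
  exists (mu 0); split=> [k|k||] //; first by rewrite mxE; case: ifP.
  by rewrite /= negbK mxE => ->.
pose y := z^T - (hmat p *m z^T) i 0 *: ycol 0 1.
have yE k : (hmat p *m y) k 0 = (hmat p *m z^T) k 0 - (hmat p *m z^T) i 0.
  rewrite mulmxBr -scalemxAr mxE [X in _ + X]mxE [X in _ - X]mxE hmat_ycol.
  by rewrite dot0p subr0 mulr1.
have zi : (hmat p *m z^T) i 0 < 0.
  suff -> : (hmat p *m z^T) i 0 = (z *m (row i (hmat p))^T) 0 0 by [].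
  by rewrite -[z in RHS]trmxK -trmx_mul -row_mul !mxE.
have zk k : k != i -> 0 <= (hmat p *m z^T) k 0.
  move=> ki; suff -> : (hmat p *m z^T) k 0 = (z *m (row_mask [set~ i] (hmat p))^T) 0 k by [].
  by rewrite -[z in RHS]trmxK -trmx_mul row_mask_mul [RHS]mxE row_maskE !inE ki.
apply/is_faceP; exists y => [k|].
  by rewrite yE; have [->|/zk] := eqVneq k i; [rewrite subrr | lra].
apply/setP => k; rewrite !inE yE; have [->|ki] := eqVneq k i; first by rewrite subrr eqxx.
by apply/esym/negbTE; rewrite gt_eqF //; have := zk k ki; lra.
Qed.

Lemma vertex_conv i (nu : 'rV[R]_v) (t : R) : 0 < t -> (forall k, 0 <= nu 0 k) ->
  nu *m hmat p = t *: row_mx (p i) 1 -> forall k, k != i -> nu 0 k = 0.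
Proof.
move=> t0 nu0 nuE k ki; have /is_faceP[y y0 yE] := vertex_exposed i.
have yi : (hmat p *m y) i 0 = 0.
  by have := set11 i; rewrite yE inE => /eqP.
have : (nu *m hmat p *m y) 0 0 = 0.
  by rewrite nuE -row_hmat -scalemxAl -row_mul 2!mxE yi mulr0.
rewrite -mulmxA mxE => /psumr_eq0P H.
have /eqP := H (fun k _ => mulr_ge0 (nu0 k) (y0 k)) k isT.
rewrite mulf_eq0 => /orP[/eqP//|yk].
suff : k \in [set i] by rewrite inE (negPf ki).
by rewrite yE inE.
Qed.

Lemma vertex_inj : injective p.
Proof.
move=> i j pij; apply/eqP; apply/negPn/negP => ij.
have := @vertex_conv i (delta_mx 0 j) 1 ltr01 _ _ j _.
rewrite !mxE !eqxx /= => H; suff /eqP : 1 = 0 :> R by rewrite oner_eq0.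
apply: H; last by rewrite eq_sym.
  by move=> k; rewrite mxE eqxx /=; case: eqP.
by rewrite -rowE row_hmat pij scale1r.
Qed.

End Vertices.

Section Polytope.
Variables (d v f : nat) (p : 'I_v -> 'rV[R]_d) (F : 'I_f -> 'rV[R]_d * R).

Definition ymat : 'M[R]_(d + 1, f) := \matrix_(i, j) ycol (F j).1 (F j).2 i 0.
Definition smat : 'M[R]_(v, f) := hmat p *m ymat.
Definition vset (j : 'I_f) : {set 'I_v} := [set i | incident p F i j].

Lemma col_ymat j : col j ymat = ycol (F j).1 (F j).2.
Proof. by apply/colP => i; rewrite mxE mxE. Qed.

Lemma smat_ycol i j : smat i j = (hmat p *m ycol (F j).1 (F j).2) i 0.
Proof. by rewrite -col_ymat colE mulmxA -colE [RHS]mxE. Qed.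

Lemma vset_zeros j : vset j = zeros (hmat p) (ycol (F j).1 (F j).2).
Proof. by apply/setP => i; rewrite !inE hmat_ycol subr_eq0 eq_sym. Qed.

Hypotheses (fp : full_dim p) (lF : facet_labelling p F).

Lemma smat_pattern : has_pattern vset smat.
Proof.
move=> i j; rewrite vset_zeros inE smat_ycol; split=> //.
by case: lF => /(_ j)[_ /valid_ineqP].
Qed.

Let fullH := full_dim_rank fp.

Lemma vset_rank j : (d + 1 <= (\rank (row_mask (vset j) (hmat p))).+1)%N.
Proof. by rewrite vset_zeros; apply: facet_ineq_rank; case: lF. Qed.

Lemma ycol_neq0 j : ycol (F j).1 (F j).2 != 0.
Proof.
case: lF => /(_ j)[a0 _ _] _ _; apply: contra a0; rewrite col_mx_eq0 oppr_eq0 => /andP[/eqP e _].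
by rewrite -[_.1]trmxK e trmx0.
Qed.

Lemma vset_inj : injective vset.
Proof.
move=> j k jk; case: lF => _ inj _; apply: inj => x /in_conv_row[lam lam0 xE].
suff tight l : dotp (F l).1 x = (F l).2 <-> forall i, 0 < lam 0 i -> i \in vset l.
  by split=> /tight H; apply/tight; [rewrite -jk|rewrite jk].
have e : (F l).2 - dotp (F l).1 x = \sum_i lam 0 i * smat i l.
  by rewrite -row_ycol xE -mulmxA mxE; apply: eq_bigr => i _; rewrite smat_ycol.
have P i := smat_pattern i l.
split=> [t i li|H].
  move: e; rewrite t subrr => /esym/psumr_eq0P H.
  have /eqP := H (fun i _ => mulr_ge0 (lam0 i) (P i).1) i isT.
  by rewrite mulf_eq0 gt_eqF //= (P i).2.
apply/esym/eqP; rewrite -subr_eq0 e big1 // => i _.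
have [->|li] := eqVneq (lam 0 i) 0; first by rewrite mul0r.
have := H i; rewrite lt0r li lam0 => /(_ isT); rewrite -(P i).2 => /eqP ->.
by rewrite mulr0.
Qed.

(** The vertices of a facet have corank at most one, so a facet functional vanishing on them is a
    nonzero multiple of the given one. *)
Lemma vset_facin j : facin vset setT j.
Proof.
have [i0 i0j] := full_mul_neq0 fullH (ycol_neq0 j).
apply/andP; split; first by apply/subsetPn; exists i0; rewrite ?vset_zeros ?inE.
apply/forallP => k; apply/implyP; rewrite setTI => jk; apply/orP; right.
have [||t tE] := corank1_line fullH (vset_rank j) (ycol_neq0 j) _ _ (y := ycol (F k).1 (F k).2).
- by move=> i; rewrite vset_zeros inE => /eqP.
- by move=> i /(subsetP jk); rewrite vset_zeros inE => /eqP.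
have t0 : t != 0 by apply: contraNneq (ycol_neq0 k) => t0; rewrite tE t0 scale0r.
rewrite setTI; apply/subsetP => i; rewrite !vset_zeros !inE tE -scalemxAr mxE mulf_eq0.
by rewrite (negPf t0).
Qed.

Hypothesis d0 : (0 < d)%N.

(** A functional separating [z] from the cone over the polytope can be rotated to a facet
    inequality. That is a nonnegative multiple of a labelled one, so it cannot be negative at
    [z]. *)
Lemma cone_hrep (z : 'rV[R]_(d + 1)) : (forall j, 0 <= (z *m ymat) 0 j) ->
  exists2 lam : 'rV[R]_v, (forall k, 0 <= lam 0 k) & z = lam *m hmat p.
Proof.
move=> zY; have [[lam [lam0 lamE]]|[w [w0 wz]]] := farkas (hmat p)^T z^T.
  exists lam^T => [k|]; first by rewrite mxE.
  by rewrite -[LHS]trmxK lamE trmx_mul trmxK.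
have [||y [y0 zy rk]] := @rotate_to_facet _ _ _ _ fullH z w^T.
- by move=> i; have := w0 i; rewrite -[w in X in X -> _]trmxK -trmx_mul mxE.
- by move: wz; rewrite -[w in X in X -> _]trmxK -trmx_mul mxE.
have [a [b yE]] := ycol_ex y; rewrite {}yE in y0 zy rk.
(* If [a] were zero, the functional would be a nonzero constant on the points; none would be tight,
   and rank zero is too small because $d>0$. *)
have a0 : a != 0.
  apply: contraTneq rk => a0; rewrite -ltnNge [ltnRHS]addn1 ltnS.
  suff -> : zeros (hmat p) (ycol a b) = set0.
    suff -> : row_mask set0 (hmat p) = 0 by rewrite mxrank0.
    by apply/matrixP => i j; rewrite row_maskE inE mxE.
  apply/setP => i; rewrite !inE hmat_ycol a0 dot0p subr0.
  apply/negP => /eqP b0; move: zy; rewrite a0 b0 /ycol trmx0 oppr0.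
  by rewrite (_ : 0%:M = 0) ?col_mx0 ?mulmx0 ?mxE ?ltxx //; apply/matrixP => ? ?; rewrite !mxE mul0rn.
have fab := rank_facet_ineq a0 y0 rk.
case: (lF) => _ _ /(_ a b fab)[j jE].
have zE : zeros (hmat p) (ycol a b) = vset j.
  apply/setP => i; rewrite vset_zeros !inE !hmat_ycol !subr_eq0 ![_ == dotp _ _]eq_sym.
  by apply/eqP/eqP => /(jE _ (in_conv_vertex p i)).
have [||t tE] := corank1_line fullH (vset_rank j) (ycol_neq0 j) _ _ (y := ycol a b).
- by move=> i; rewrite vset_zeros inE => /eqP.
- by move=> i; rewrite -zE inE => /eqP.
have [i0 i0j] := full_mul_neq0 fullH (ycol_neq0 j).
have t0 : 0 <= t.
  have := y0 i0; rewrite tE -scalemxAr mxE pmulr_lge0 // lt0r i0j.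
  by have := (smat_pattern i0 j).1; rewrite smat_ycol.
move: zy; rewrite tE -scalemxAr mxE ltNge mulr_ge0 //.
by have := zY j; rewrite -col_ymat colE mulmxA -colE [X in _ -> 0 <= X]mxE.
Qed.

(** A vector killed by all facet functionals lies, together with its opposite, in the cone over the
    polytope, which is pointed because every generator has last coordinate 1. *)
Lemma ymat_free : row_free ymat.
Proof.
apply/inj_row_free => u uY.
have [|l1 l10 l1E] := cone_hrep (z := u); first by move=> j; rewrite uY mxE.
have [|l2 l20 l2E] := cone_hrep (z := - u); first by move=> j; rewrite mulNmx uY oppr0 mxE.
have : (l1 + l2) *m hmat p = 0 by rewrite mulmxDl -l1E -l2E subrr.
rewrite mul_hmat => /(congr1 rsubmx); rewrite row_mxKr => /matrixP/(_ 0 0).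
rewrite !mxE mulr1n => /psumr_eq0P s0.
rewrite l1E; suff -> : l1 = 0 by rewrite mul0mx.
apply/rowP => k; rewrite mxE.
have s1 i : 0 <= (l1 + l2) 0 i by rewrite mxE addr_ge0.
have := s0 (fun i _ => s1 i) k isT; rewrite mxE.
by have := l10 k; have := l20 k; lra.
Qed.

Lemma smat_rank : \rank smat = (d + 1)%N.
Proof. by rewrite mxrankMfree ?ymat_free. Qed.

(** Dual use of Farkas: a certificate against [y] is nonnegative on all facets, so by [cone_hrep] it
    is a nonnegative combination of the homogenized points, where [y] is nonnegative. *)
Lemma smat_conic : conic smat setT.
Proof.
move=> y y0; have [[lam [lam0 lamE]]|[z [z0 zc]]] := farkas ymat (ymat *m y).
  by exists lam => // i _; rewrite -!mulmxA lamE.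
have [lam lam0 lamE] := cone_hrep z0.
move: zc; rewrite lamE -mulmxA (mulmxA (hmat p)) -/smat mxE ltNge sumr_ge0 // => k _.
by rewrite mulr_ge0 // y0 // inE.
Qed.

Lemma is_face_smat A : is_face p A <->
  exists2 lam : 'cV[R]_f, (forall j, 0 <= lam j 0) & A = common_zeros vset lam.
Proof. exact: (is_face_conic A ymat_free smat_pattern smat_conic). Qed.

Lemma vset_separated i k : vertex_family p ->
  (forall j, i \in vset j -> k \in vset j) -> k = i.
Proof.
move=> vp H; have /is_face_smat[lam lam0 lamE] := vertex_exposed vp i.
have : k \in [set i]; last by rewrite inE => /eqP.
have : i \in [set i] by rewrite inE.
rewrite !{1}lamE !inE => /forallP iF; apply/forallP => j; apply/implyP => lj.
by apply: H; exact: (implyP (iF j)).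
Qed.

Lemma vset_avoid i : exists j, i \notin vset j.
Proof.
have [/existsP//|] := boolP [exists j, i \notin vset j].
rewrite negb_exists => /forallP H.
have : row i (hmat p) *m ymat = 0.
  rewrite -row_mul; apply/rowP => j; rewrite mxE [RHS]mxE; apply/eqP.
  by rewrite (smat_pattern i j).2; have := H j; rewrite negbK.
have /row_free_inj inj := ymat_free; rewrite -(mul0mx _ ymat) => /inj.
rewrite row_hmat => /(congr1 rsubmx); rewrite row_mxKr => /matrixP/(_ 0 0).
by rewrite !mxE => /eqP; rewrite oner_eq0.
Qed.

End Polytope.

(** * Projective equivalence *)

(** Complete the all-ones vector to a basis of the column space of [N]: the other [d] basis vectors
    list the coordinates of the points [q i]. *)
Lemma hmat_factor (d v f : nat) (N : 'M[R]_(v, f)) (y : 'cV[R]_f) : (0 < v)%N ->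
  \rank N = (d + 1)%N -> N *m y = const_mx 1 ->
  exists (q : 'I_v -> 'rV[R]_d) (X : 'M[R]_(d + 1, f)),
    [/\ N = hmat q *m X, row_free X & \rank (hmat q) = (d + 1)%N].
Proof.
move=> v0 rN Ny; pose one : 'rV[R]_v := const_mx 1.
have sone : (one <= N^T)%MS.
  by apply/submxP; exists y^T; rewrite -trmx_mul Ny trmx_const.
have rone : \rank one = 1%N.
  rewrite rank_rV; suff -> : one != 0 by [].
  by apply/eqP => /rowP/(_ (Ordinal v0))/eqP; rewrite !mxE oner_eq0.
have capE : (N^T :&: one :=: one)%MS by apply/capmx_idPr.
have rW : \rank (N^T :\: one)%MS = d.
  have := mxrank_cap_compl N^T one; rewrite capE rone mxrank_tr rN; lia.
pose W : 'M[R]_(d, v) := castmx (rW, erefl) (row_base (N^T :\: one)%MS).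
have WE : (W :=: N^T :\: one)%MS.
  by apply: eqmx_trans (eqmx_cast _ _) (eq_row_base _).
pose q i : 'rV[R]_d := \row_k W k i.
have qE : (hmat q)^T = col_mx W one.
  apply/matrixP => i j; rewrite !mxE; by case: splitP => k _; rewrite !mxE ?[k]ord1.
have qN : ((hmat q)^T :=: N^T)%MS.
  rewrite qE; apply: eqmx_trans (eqmx_sym (addsmxE _ _)) _.
  apply: eqmx_trans (adds_eqmx WE (eqmx_sym capE)) _.
  exact: addsmx_diff_cap_eq.
have rq : \rank (hmat q) = (d + 1)%N by rewrite -mxrank_tr qN mxrank_tr.
have /submxP[D DE] : (N^T <= (hmat q)^T)%MS by rewrite qN.
have NE : N = hmat q *m D^T by rewrite -[LHS]trmxK DE trmx_mul trmxK.
exists q, D^T; split=> //; rewrite /row_free eqn_leq rank_leq_row -[leqLHS]rN NE.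
exact: mxrankM_maxr.
Qed.

Lemma proj_mapE (d : nat) (M : 'M[R]_(d + 1)) (x : 'rV[R]_d) :
  rsubmx (hom_img M x) 0 0 != 0 ->
  hom_img M x = rsubmx (hom_img M x) 0 0 *: row_mx (proj_map M x) 1.
Proof.
move=> nz; rewrite scale_row_mx /proj_map scalerA mulfV // scale1r -[LHS]hsubmxK.
by rewrite [X in row_mx _ X = _]mx11_scalar scalemx1.
Qed.

Lemma row_mx1_scale (d : nat) (x y : 'rV[R]_d) (s t : R) :
  s *: row_mx x (1 : 'rV[R]_1) = t *: row_mx y 1 -> s = t /\ (s != 0 -> x = y).
Proof.
rewrite !scale_row_mx => /eq_row_mx[xy /matrixP/(_ 0 0)].
by rewrite !mxE !mulr1 => st; split=> // s0; apply: (scalerI s0); rewrite xy st.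
Qed.

(** A preimage of [q i] is a convex combination of the [p k], and once the denominators have one
    sign, [q i] is a convex combination of the images of the [p k]. As [q i] is a vertex, every
    [p k] of positive weight is mapped to it. *)
Lemma proj_equiv_vertices (d v w : nat) (p : 'I_v -> 'rV[R]_d) (q : 'I_w -> 'rV[R]_d)
    (i0 : 'I_w) : vertex_family q -> proj_equiv p q ->
  exists (M : 'M[R]_(d + 1)) (sigma : 'I_w -> 'I_v) (c : 'I_w -> R),
    [/\ M \in unitmx, injective sigma, forall i, 0 < c i
      & forall i, row_mx (p (sigma i)) 1 *m M = c i *: row_mx (q i) 1].
Proof.
move=> vq [M [uM nzM inM outM]].
pose den k := rsubmx (hom_img M (p k)) 0 0.
have den0 k : den k != 0 by apply/nzM/in_conv_vertex.
have [k0 _] : exists k0 : 'I_v, true.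
  have [x0 [lam [_ _ s1 _]] _] := outM (q i0) (in_conv_vertex q i0).
  have [k _|v0] := pickP 'I_v; first by exists k.
  by move: s1; rewrite big1 => [/eqP|k]; [rewrite eq_sym oner_eq0|have := v0 k].
pose a := den k0.
(* Two denominators of opposite sign would force a zero denominator at the point of the segment with
   weights [s] and [t]. *)
have same k : 0 < a * den k.
  have := mulf_neq0 (den0 k0) (den0 k); rewrite -/a; set b := den k => ab0.
  rewrite lt0r ab0 leNgt; apply/negP => ab.
  have ba0 : b - a != 0.
    by apply: contraTneq ab => /eqP; rewrite subr_eq0 => /eqP->; rewrite -leNgt -expr2 sqr_ge0.
  pose s := b / (b - a); pose t := - a / (b - a).
  have st : s + t = 1 by rewrite /s /t; field.
  have sq : 0 <= ((b - a)^-1) ^+ 2 by rewrite sqr_ge0.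
  have s0 : 0 <= s.
    have -> : s = (b ^+ 2 - a * b) * ((b - a)^-1) ^+ 2 by rewrite /s; field.
    by rewrite mulr_ge0 // subr_ge0 (le_trans (ltW ab)) ?sqr_ge0.
  have t0 : 0 <= t.
    have -> : t = (a ^+ 2 - a * b) * ((b - a)^-1) ^+ 2 by rewrite /t; field.
    by rewrite mulr_ge0 // subr_ge0 (le_trans (ltW ab)) ?sqr_ge0.
  have xE : row_mx (s *: p k0 + t *: p k) 1 =
      (s *: delta_mx 0 k0 + t *: delta_mx 0 k) *m hmat p.
    rewrite mulmxDl -!scalemxAl -!rowE !row_hmat !scale_row_mx add_row_mx -scalerDl st.
    by rewrite scale1r.
  have xc : in_conv p (s *: p k0 + t *: p k).
    apply/in_conv_row; exists (s *: delta_mx 0 k0 + t *: delta_mx 0 k) => // l.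
    by rewrite !mxE !eqxx /= addr_ge0 // mulr_ge0 // ler0n.
  have /eqP := nzM _ xc; apply; rewrite /hom_img xE mulmxDl -!scalemxAl -!rowE !row_hmat.
  rewrite mulmxDl -!scalemxAl linearD !linearZ mxE [X in X + _]mxE [X in _ + X]mxE.
  by rewrite -!/(hom_img _ _) -/(den _) -/(den _) -/a -/b /s /t; field.
have key i : exists k, row_mx (p k) 1 *m M = den k *: row_mx (q i) 1.
  have [x xp xq] := outM (q i) (in_conv_vertex q i).
  have dx := nzM _ xp; have /in_conv_row[lam lam0 xE] := xp.
  have /fin_all_exists2[nu nu0 nuE] k :=
    (in_conv_row q (proj_map M (p k))).1 (inM _ (in_conv_vertex p k)).
  have pkE k : row_mx (p k) 1 *m M = den k *: (nu k *m hmat q).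
    by rewrite -nuE -proj_mapE // -/(den k).
  pose mu : 'rV[R]_w := \sum_k (lam 0 k * (a * den k)) *: nu k.
  have muE : mu *m hmat q = (a * rsubmx (hom_img M x) 0 0) *: row_mx (q i) 1.
    rewrite -scalerA -xq -proj_mapE // /hom_img xE -mulmxA [lam *m _]mulmx_sum_row scaler_sumr.
    rewrite mulmx_suml; apply: eq_bigr => k _.
    by rewrite row_mul row_hmat pkE !scalerA -scalemxAl; congr (_ *: _); ring.
  have mu0 l : 0 <= mu 0 l.
    by rewrite summxE sumr_ge0 // => k _; rewrite mxE mulr_ge0 // mulr_ge0 // ltW.
  have ax0 : 0 < a * rsubmx (hom_img M x) 0 0.
    rewrite lt0r (mulf_neq0 (den0 k0 : a != 0) dx) /=; move: muE; rewrite mul_hmat scale_row_mx.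
    move=> /eq_row_mx[_ /matrixP/(_ 0 0)]; rewrite !mxE !mulr1n mulr1 => <-.
    by rewrite sumr_ge0.
  have [k lk] : exists k, 0 < lam 0 k.
    have : ~~ [forall k, lam 0 k == 0].
      apply/negP => /forallP l0; move: xE; suff -> : lam = 0.
        rewrite mul0mx => /(congr1 rsubmx); rewrite row_mxKr => /matrixP/(_ 0 0)/eqP.
        by rewrite !mxE oner_eq0.
      by apply/rowP => k; rewrite mxE; apply/eqP.
    by rewrite negb_forall => /existsP[k lk]; exists k; rewrite lt0r lk lam0.
  exists k; rewrite pkE; congr (_ *: _).
  have nuk l : l != i -> nu k 0 l = 0.
    move=> li; have := vertex_conv vq ax0 mu0 muE li.
    rewrite summxE => /psumr_eq0P H.
    have P k' : 0 <= ((lam 0 k' * (a * den k')) *: nu k') 0 l.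
      by rewrite mxE mulr_ge0 // mulr_ge0 // ltW.
    have /eqP := H (fun k' _ => P k') k isT.
    by rewrite mxE mulf_eq0 (gt_eqF (mulr_gt0 lk (same k))) /= => /eqP.
  have nuE2 : nu k = nu k 0 i *: delta_mx 0 i.
    apply/rowP => l; rewrite !mxE eqxx /=; have [->|/nuk->] := eqVneq l i.
      by rewrite mulr1.
    by rewrite mulr0.
  have e1 : 1 *: row_mx (proj_map M (p k)) 1 = nu k 0 i *: row_mx (q i) (1 : 'rV[R]_1).
    by rewrite scale1r nuE {1}nuE2 -scalemxAl -rowE row_hmat.
  by case/row_mx1_scale: e1 => _ /(_ (oner_neq0 _)) e; rewrite -nuE e.
have /fin_all_exists[sigma sigmaE] := key.
exists (a *: M), sigma, (fun i => a * den (sigma i)); split=> [|i j e||i].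
- by rewrite unitmxZ // unitfE (den0 k0).
- have := sigmaE i; rewrite e sigmaE => /row_mx1_scale[_ /(_ (den0 _))] qe.
  exact/esym/(vertex_inj vq).
- by move=> i; exact: same.
- by rewrite -scalemxAr sigmaE scalerA.
Qed.

Lemma row_mx1_lsubmx (d v : nat) (p : 'I_v -> 'rV[R]_d) (lam : 'rV[R]_v) :
  \sum_k lam 0 k = 1 -> row_mx (lsubmx (lam *m hmat p)) 1 = lam *m hmat p.
Proof. by move=> s1; rewrite mul_hmat s1 row_mxKl. Qed.

Lemma proj_equiv_vertex_map (d v w : nat) (p : 'I_v -> 'rV[R]_d) (q : 'I_w -> 'rV[R]_d)
    (M : 'M[R]_(d + 1)) (k : 'I_v -> 'I_w) (g : 'I_w -> 'I_v) (c : 'I_v -> R) :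
  cancel k g -> cancel g k -> M \in unitmx -> (forall i, 0 < c i) ->
  (forall i, row_mx (p i) 1 *m M = c i *: row_mx (q (k i)) 1) -> proj_equiv p q.
Proof.
move=> kg gk uM c0 pM.
have push (lam : 'rV[R]_v) :
    lam *m hmat p *m M = (\row_l (lam 0 (g l) * c (g l))) *m hmat q.
  rewrite -mulmxA mulmx_sum_row [RHS]mulmx_sum_row (reindex k) /=; last first.
    by exists g => ? _; rewrite ?kg ?gk.
  by apply: eq_bigr => i _; rewrite row_mul !row_hmat pM mxE kg scalerA.
have den (lam : 'rV[R]_v) x : (forall i, 0 <= lam 0 i) -> row_mx x 1 = lam *m hmat p ->
    0 < \sum_l (\row_l (lam 0 (g l) * c (g l)) : 'rV[R]_w) 0 l.
  move=> lam0 xE; have t0 l : 0 <= (\row_l (lam 0 (g l) * c (g l)) : 'rV[R]_w) 0 l.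
    by rewrite mxE mulr_ge0 // ltW.
  rewrite lt0r sumr_ge0 ?andbT //; apply/eqP => /psumr_eq0P H.
  have l0 : lam = 0.
    apply/rowP => i; have /eqP := H (fun l _ => t0 l) (k i) isT.
    by rewrite !mxE kg mulf_eq0 [X in _ || X]gt_eqF // orbF => /eqP.
  move: xE; rewrite l0 mul0mx => /(congr1 rsubmx); rewrite row_mxKr => /matrixP/(_ 0 0)/eqP.
  by rewrite !mxE oner_eq0.
have denE (lam : 'rV[R]_v) x : row_mx x 1 = lam *m hmat p ->
    rsubmx (hom_img M x) 0 0 = \sum_l (\row_l (lam 0 (g l) * c (g l)) : 'rV[R]_w) 0 l.
  by move=> xE; rewrite /hom_img xE push mul_hmat row_mxKr mxE mulr1n.
exists M; split=> // [x|x|y].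
- by case/in_conv_row => lam lam0 xE; rewrite (denE _ _ xE) gt_eqF // (den _ x).
- case/in_conv_row => lam lam0 xE; have W0 := den _ _ lam0 xE.
  have W1 : rsubmx (hom_img M x) 0 0 != 0 by rewrite (denE _ _ xE) gt_eqF.
  have := proj_mapE W1; set W := rsubmx _ _ _ => e.
  apply/in_conv_row; exists (W^-1 *: \row_l (lam 0 (g l) * c (g l))) => [l|].
    by rewrite !mxE mulr_ge0 ?invr_ge0 /W ?(denE _ _ xE) ?(ltW W0) // mulr_ge0 // ltW.
  by rewrite -scalemxAl -push -xE -/(hom_img M x) e scalerA mulVf // scale1r.
- case/in_conv_row => nu nu0 yE.
  (* To find a preimage of [y], its weights are divided by the factors [c] and renormalized by their
     sum. *)
  pose s := \sum_i nu 0 (k i) / c i.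
  have s0 : 0 < s.
    have t0 i : 0 <= nu 0 (k i) / c i by rewrite divr_ge0 // ltW.
    rewrite lt0r sumr_ge0 ?andbT //; apply/eqP => /psumr_eq0P H.
    have n0 : nu = 0.
      apply/rowP => l; have /eqP := H (fun i _ => t0 i) (g l) isT.
      by rewrite gk mulf_eq0 invr_eq0 [X in _ || X]gt_eqF // orbF mxE => /eqP.
    move: yE; rewrite n0 mul0mx => /(congr1 rsubmx); rewrite row_mxKr => /matrixP/(_ 0 0)/eqP.
    by rewrite !mxE oner_eq0.
  pose lam : 'rV[R]_v := \row_i (s^-1 * (nu 0 (k i) / c i)).
  have lam0 i : 0 <= lam 0 i by rewrite mxE !mulr_ge0 ?invr_ge0 // ltW.
  have xE : row_mx (lsubmx (lam *m hmat p)) 1 = lam *m hmat p.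
    apply: row_mx1_lsubmx; under eq_bigr do rewrite mxE.
    by rewrite -mulr_sumr mulVf // gt_eqF.
  exists (lsubmx (lam *m hmat p)); first by apply/in_conv_row; exists lam.
  have W0 := den _ _ lam0 xE; set x := lsubmx _ in xE W0 *.
  have W1 : rsubmx (hom_img M x) 0 0 != 0 by rewrite (denE _ _ xE) gt_eqF.
  have := proj_mapE W1; set W := rsubmx _ _ _; rewrite {1}/hom_img xE push => e.
  have : W *: row_mx (proj_map M x) 1 = s^-1 *: row_mx y 1.
    rewrite -e yE scalemxAl; congr (_ *m _); apply/rowP => l.
    by rewrite !mxE gk -mulrA divfK // gt_eqF.
  by case/row_mx1_scale => _; apply.
Qed.

(** * Realization of low-rank matrices with the slack pattern *)

Section Realize.
Variables (d v f : nat) (p : 'I_v -> 'rV[R]_d) (F : 'I_f -> 'rV[R]_d * R).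
Hypotheses (vp : vertex_family p) (fp : full_dim p) (lF : facet_labelling p F).
Hypothesis d0 : (0 < d)%N.
Local Notation S := (smat p F).
Local Notation vset := (vset p F).

Lemma realize_comb (M : 'M[R]_(v, f)) :
  has_pattern vset M -> (\rank M <= d + 1)%N ->
  exists (q : 'I_v -> 'rV[R]_d) (X : 'M[R]_(d + 1, f)) (r : 'I_v -> R),
    [/\ vertex_family q, comb_equiv p q, row_free X, forall i, 0 < r i
      & forall i j, M i j = r i * (hmat q *m X) i j].
Proof.
move=> pM rM; have pS := smat_pattern lF; have cS := smat_conic fp lF d0.
have rS := smat_rank fp lF d0.
have cM : conic M setT by apply: (conic_transfer pS pM cS); rewrite rS.
have rME : \rank M = (d + 1)%N.
  apply/eqP; rewrite eqn_leq rM -[leqLHS]rS.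
  by have := mxrank_pattern_le pS pM cS; rewrite !row_maskT.
pose r i := \sum_j M i j.
have r0 i : 0 < r i.
  have [j ij] := vset_avoid fp lF d0 i; rewrite /r (bigD1 j) //=.
  rewrite ltr_wpDr ?sumr_ge0 // => [k _|]; first by case: (pM i k).
  by rewrite lt0r (pM i j).2 ij (pM i j).1.
pose N : 'M[R]_(v, f) := diag_mx (\row_i (r i)^-1) *m M.
have NE i j : N i j = (r i)^-1 * M i j by rewrite /N mul_diag_mx !mxE.
have uD : diag_mx (\row_i (r i)^-1) \in unitmx.
  rewrite unitmxE det_diag unitfE; apply/prodf_neq0 => i _.
  by rewrite mxE invr_eq0 gt_eqF.
have rN : \rank N = (d + 1)%N by rewrite eqmxMfull // row_full_unit.
have pN : has_pattern vset N.
  move=> i j; rewrite NE mulf_eq0 invr_eq0 (gt_eqF (r0 i)) (pM i j).2; split=> //.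
  by rewrite mulr_ge0 ?(pM i j).1 // invr_ge0 ltW.
have cN : conic N setT by apply: (conic_transfer pS pN cS); rewrite rS rN.
have v0 : (0 < v)%N by rewrite (leq_trans _ (rank_leq_row M)) // rME addn1.
have N1 : N *m const_mx 1 = const_mx 1 :> 'cV[R]_v.
  apply/colP => i; rewrite [LHS]mxE [RHS]mxE; under eq_bigr do rewrite NE mxE mulr1.
  by rewrite -mulr_sumr mulVf // gt_eqF.
have [q [X [NX fX _]]] := hmat_factor v0 rN N1.
exists q, X, r; split=> // [i||i j]; last first.
- by rewrite -NX NE mulrA mulfV ?mul1r // gt_eqF.
- rewrite NX in pN cN.
  have faceE A : is_face p A <-> is_face q A.
    by apply: iff_trans (is_face_smat fp lF d0 A) (iff_sym (is_face_conic A fX pN cN)).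
  exists id; split=> [A /faceE//|A /faceE Ap|//]; by exists A.
case=> lam [lam0 lami s1 qE].
have e : row_mx (q i) 1 = (\row_k lam k) *m hmat q.
  rewrite mul_hmat; under [in RHS]eq_bigr do rewrite mxE.
  by under [X in X%:M]eq_bigr do rewrite mxE; rewrite s1 -qE.
have [k lk] : exists k, 0 < lam k.
  have : ~~ [forall k, lam k == 0].
    apply/negP => /forallP l0; move: s1; rewrite big1 => [/eqP|k _]; last exact/eqP.
    by rewrite eq_sym oner_eq0.
  by rewrite negb_forall => /existsP[k lk]; exists k; rewrite lt0r lk lam0.
(* Every facet through [i] contains [k], since the weight at [k] is positive; the facets of [p]
   separate its vertices. *)
have ki : k = i.
  apply: (vset_separated fp lF d0 vp) => j; rewrite -(pN i j).2 -(pN k j).2 => /eqP Nij.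
  have : (row_mx (q i) 1 *m X) 0 j = 0 by rewrite -row_hmat -row_mul mxE -NX.
  rewrite e -mulmxA -NX mxE => /psumr_eq0P H.
  have P l : 0 <= (\row_k lam k) 0 l * N l j by rewrite mxE mulr_ge0 // (pN l j).1.
  by have /eqP := H (fun l _ => P l) k isT; rewrite mxE mulf_eq0 gt_eqF.
by move: lk; rewrite ki lami ?ltxx //= negbK.
Qed.

Lemma realize (M : 'M[R]_(v, f)) :
  proj_unique p -> has_pattern vset M -> (\rank M <= d + 1)%N ->
  exists (sigma : 'I_v -> 'I_v) (tau : 'I_f -> 'I_f) (s : 'I_v -> R) (u : 'I_f -> R),
    [/\ injective sigma, injective tau, forall i, 0 < s i, forall j, 0 < u j
      & forall i j, M i j = s i * u j * S (sigma i) (tau j)].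
Proof.
move=> up pM rM; have pS := smat_pattern lF; have cS := smat_conic fp lF d0.
have rS := smat_rank fp lF d0; have fH := full_dim_rank fp.
have [q [X [r [vq ce fX r0 ME]]]] := realize_comb pM rM.
have pN : has_pattern vset (hmat q *m X).
  move=> i j; have := pM i j; rewrite ME mulf_eq0 (gt_eqF (r0 i)) /= => -[+ ->].
  by rewrite pmulr_rge0.
have v0 : (0 < v)%N by rewrite (leq_trans _ (rank_leq_row S)) // rS addn1.
have [T [sigma [c [uT isig c0 qE]]]] := proj_equiv_vertices (Ordinal v0) vq (up _ _ vq ce).
have [sg' sK Ks] : bijective sigma by apply: injF_bij.
(* Column [j] of [X], transported to a functional on [p] by the projective map. *)
pose y j := T *m col j X.
have yE j i : (hmat p *m y j) (sigma i) 0 = c i * (hmat q *m X) i j.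
  have -> : (hmat p *m y j) (sigma i) 0 = (row_mx (p (sigma i)) 1 *m y j) 0 0.
    by rewrite -row_hmat -row_mul [RHS]mxE.
  rewrite mulmxA qE -scalemxAl mxE; congr (_ * _).
  by rewrite -row_hmat -row_mul mxE colE mulmxA -colE mxE.
have sigrank (A : {set 'I_v}) :
    (\rank (row_mask A (hmat q)) <= \rank (row_mask (sigma @: A) (hmat p)))%N.
  have -> : row_mask A (hmat q) =
      (\matrix_(i, k) if k == sigma i then (c i)^-1 else 0)
        *m row_mask (sigma @: A) (hmat p) *m T.
    apply/row_matrixP => i; rewrite !row_mul.
    have -> : row i (\matrix_(i, k) if k == sigma i then (c i)^-1 else 0) =
        (c i)^-1 *: delta_mx 0 (sigma i) :> 'rV[R]_v.
      by apply/rowP => k; rewrite !mxE eqxx /=; case: eqP; rewrite ?mulr1 ?mulr0.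
    rewrite -!scalemxAl -rowE.
    have rowm (w : nat) (B : {set 'I_w}) (H : 'M[R]_(w, d + 1)) k :
        row k (row_mask B H) = if k \in B then row k H else 0.
      by apply/rowP => l; rewrite mxE row_maskE; case: ifP; rewrite mxE.
    rewrite !rowm mem_imset //; case: ifP => _; last by rewrite mul0mx scaler0.
    by rewrite !row_hmat qE scalerA mulVf ?scale1r // gt_eqF.
  by rewrite -mulmxA; apply: leq_trans (mxrankM_maxr _ _) (mxrankM_maxl _ _).
(* By [mxrank_pattern_le] the rank on facet [j] is no smaller for [q] than for [p], and the
   projective map carries it back to the points matched by [sigma]. *)
have vrank j : (d + 1 <= (\rank (row_mask (sigma @: vset j) (hmat p))).+1)%N.
  apply: leq_trans (vset_rank lF j) _; rewrite ltnS.
  apply: leq_trans (sigrank _).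
  have := mxrank_pattern_le pS pN (conic_setI (j := j) pS cS); rewrite setTI.
  rewrite -!row_mask_mul (mxrankMfree _ (ymat_free fp lF d0)) => le.
  exact: leq_trans le (mxrankM_maxl _ _).
(* The transported functional is nonnegative on [p], so by conicity some facet [k] contains all the
   points matched with facet [j]. These have corank at most one, so the two functionals are
   proportional. *)
have key j : exists ku : 'I_f * R,
    0 < ku.2 /\ forall i, (hmat q *m X) i j = (c i)^-1 * ku.2 * S (sigma i) ku.1.
  have y0 k : 0 <= (hmat p *m y j) k 0.
    by rewrite -(Ks k) yE mulr_ge0 ?(ltW (c0 _)) // (pN _ _).1.
  have /row_freeP[Y YE] := ymat_free fp lF d0.
  have ypE : hmat p *m y j = S *m (Y *m y j).
    by rewrite /smat -!mulmxA (mulmxA _ Y) YE mul1mx.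
  have [|lam lam0 lamE] := cS (Y *m y j); first by rewrite -ypE => k _; exact: y0.
  have /andP[/subsetPn[i1 _ i1j] _] := vset_facin fp lF j.
  have Ni1 : 0 < (hmat q *m X) i1 j by rewrite lt0r (pN i1 j).2 i1j (pN i1 j).1.
  have [k lk] : exists k, 0 < lam k 0.
    have : ~~ [forall k, lam k 0 == 0].
      apply/negP => /forallP l0.
      have : (hmat p *m y j) (sigma i1) 0 = 0.
        rewrite ypE lamE ?inE // mxE big1 // => k _.
        by rewrite (eqP (l0 k)) mulr0.
      by move/eqP; rewrite yE mulf_eq0 !gt_eqF.
    by rewrite negb_forall => /existsP[k lk]; exists k; rewrite lt0r lk lam0.
  have jk : {in sigma @: vset j, forall i, i \in vset k}.
    move=> _ /imsetP[i ij ->]; have : (S *m lam) (sigma i) 0 = 0.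
      by rewrite -lamE ?inE // -ypE yE; apply/eqP; rewrite mulf_eq0 (pN i j).2 ij orbT.
    by move/(conic_comb_eq0 pS _ lam0); apply.
  have [||t tE] := corank1_line fH (vrank j) (ycol_neq0 lF k) _ _ (y := y j).
  - by move=> i /jk; rewrite vset_zeros inE => /eqP.
  - move=> _ /imsetP[i ij ->]; apply/eqP.
    by rewrite yE mulf_eq0 (pN i j).2 ij orbT.
  have E i : (hmat q *m X) i j = (c i)^-1 * t * S (sigma i) k.
    rewrite smat_ycol -mulrA; have -> : t * (hmat p *m ycol (F k).1 (F k).2) (sigma i) 0 =
        (hmat p *m y j) (sigma i) 0 by rewrite tE -scalemxAr [RHS]mxE.
    by rewrite yE mulrA mulVf ?mul1r // gt_eqF.
  exists (k, t); split=> //=; have := Ni1; rewrite E -mulrA pmulr_rgt0 ?invr_gt0 //.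
  rewrite ltNge => tS; rewrite ltNge; apply: contra tS => t0.
  by rewrite mulr_le0_ge0 // (pS _ _).1.
have /fin_all_exists[ku kuE] := key.
exists sigma, (fun j => (ku j).1), (fun i => r i / c i), (fun j => (ku j).2).
split=> // [j j' e|i|j|i j].
- apply: (vset_inj lF); apply/setP => i.
  have inv j1 : (i \in vset j1) = (sigma i \in vset (ku j1).1).
    rewrite -(pN i j1).2 -(pS _ _).2 (kuE j1).2 !mulf_eq0 invr_eq0.
    by rewrite (gt_eqF (c0 i)) (gt_eqF (kuE j1).1).
  by rewrite !inv e.
- by rewrite divr_gt0.
- by case: (kuE j).
- by rewrite ME (kuE j).2; ring.
Qed.

End Realize.

(** * Minors, logarithms and Laurent kernels *)

Lemma minor_eq0 (K : fieldType) (v f k : nat) (N : 'M[K]_(v, f)) (r : 'I_k -> 'I_v)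
    (c : 'I_k -> 'I_f) : (\rank N < k)%N -> \det (mxsub r c N) = 0.
Proof.
move=> rN; apply/eqP; have : mxsub r c N \notin unitmx.
  rewrite -row_free_unit /row_free neq_ltn; apply/orP; left; apply: leq_ltn_trans rN.
  rewrite -[N in leqLHS]mul1mx mxsub_mul; apply: leq_trans (mxrankM_maxr _ _) _.
  rewrite -[N in leqLHS]mulmx1 mxsub_mul; apply: leq_trans (mxrankM_maxl _ _) _.
  by rewrite (_ : rowsub id N = N) //; apply/matrixP => i j; rewrite mxE.
by rewrite unitmxE unitfE negbK.
Qed.

Lemma rank_minors (K : fieldType) (v f k : nat) (N : 'M[K]_(v, f)) :
  (forall (r : 'I_k.+1 -> 'I_v) (c : 'I_k.+1 -> 'I_f), injective r -> injective c ->
     \det (mxsub r c N) = 0) -> (\rank N <= k)%N.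
Proof.
move=> H; rewrite leqNgt; apply/negP => /exists_rowsub_free[r ir fr].
have [|c ic fc] := @exists_rowsub_free _ _ _ k.+1 (rowsub r N)^T.
  by rewrite mxrank_tr; move: fr; rewrite /row_free => /eqP->.
have := H r c ir ic; have -> : mxsub r c N = (rowsub c (rowsub r N)^T)^T.
  by apply/matrixP => i j; rewrite !mxE.
move: fc; rewrite row_free_unit unitmxE unitfE det_tr => /negPf h /eqP.
by rewrite h.
Qed.

Lemma clear_denominators (n : nat) (z : 'rV[rat]_n) :
  exists2 D : rat, D != 0 & exists m : 'rV[int]_n, D *: z = map_mx intr m.
Proof.
exists (\prod_k (denq (z 0 k))%:~R).
  by apply/prodf_neq0 => k _; rewrite intr_eq0 denq_eq0.
exists (\row_k (numq (z 0 k) * \prod_(l | l != k) denq (z 0 l))).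
apply/rowP => k; rewrite !mxE (bigD1 k) //= mulrC mulrA -{1}(divq_num_den (z 0 k)).
rewrite divfK ?intr_eq0 ?denq_eq0 // rmorphM rmorph_prod; congr (_ * _).
Qed.

(** The left kernel over [K] is extended from the rational one, hence spanned by integer vectors
    after clearing denominators; a vector orthogonal to it lies in the column space. *)
Lemma int_kernel_colspace (K : numFieldType) (n m : nat) (A : 'M[int]_(n, m)) (l : 'cV[K]_n) :
  (forall z : 'rV[int]_n, z *m A = 0 -> (map_mx intr z *m l) 0 0 = 0) ->
  exists w : 'cV[K]_m, l = map_mx intr A *m w.
Proof.
move=> H; pose AQ : 'M[rat]_(n, m) := map_mx intr A.
pose AK : 'M[K]_(n, m) := map_mx intr A.
have AE : map_mx ratr AQ = AK by apply/matrixP => i j; rewrite !mxE ratr_int.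
have kl : kermx AK *m l = 0.
  rewrite -AE -map_kermx; apply/row_matrixP => i; rewrite row_mul row0 -map_row.
  set z := row i _; have zA : z *m AQ = 0 by rewrite /z -row_mul mulmx_ker row0.
  have [D D0 [y yE]] := clear_denominators z.
  have yA : y *m A = 0.
    apply/matrixP => i0 j; apply: (@intr_inj rat); rewrite [in RHS]mxE.
    have : map_mx intr (y *m A) = 0 :> 'M[rat]__.
      by rewrite map_mxM /= -yE -scalemxAl zA scaler0.
    by move=> /matrixP/(_ i0 j); rewrite mxE [RHS]mxE.
  have DK : (ratr D : K) != 0 by rewrite fmorph_eq0.
  apply: (scalerI DK); rewrite scalemxAl -map_mxZ yE scaler0.
  apply/rowP => j; rewrite ord1 [RHS]mxE -(H y yA); congr ((_ *m l) _ _).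
  by apply/rowP => k; rewrite !mxE /= ratr_int.
have sub : (AK^T <= kermx (kermx AK)^T)%MS.
  by apply/sub_kermxP; rewrite -trmx_mul mulmx_ker trmx0.
have : (l^T <= AK^T)%MS.
  apply: (@submx_trans _ _ _ _ _ _ (kermx (kermx AK)^T)).
    by apply/sub_kermxP; rewrite -trmx_mul kl trmx0.
  rewrite -(mxrank_leqif_sup sub) mxrank_ker !mxrank_tr mxrank_ker.
  by have := rank_leq_row AK; lia.
case/submxP => D DE; exists D^T; by rewrite -[LHS]trmxK DE trmx_mul trmxK.
Qed.

Lemma lnM (x y : R) : 0 < x -> 0 < y -> ln (x * y) = ln x + ln y.
Proof. by move=> /RltP x0 /RltP y0; exact: ln_mult. Qed.

Lemma ln1 : ln 1 = 0.
Proof. exact: ln_1. Qed.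

Lemma lnXn (x : R) n : 0 < x -> ln (x ^+ n) = ln x *+ n.
Proof.
move=> x0; elim: n => [|n IHn]; first by rewrite expr0 ln1.
by rewrite exprS lnM ?exprn_gt0 // IHn mulrS.
Qed.

Lemma ln_monomial (I : finType) (x : I -> R) (m : I -> nat) : (forall k, 0 < x k) ->
  ln (\prod_k x k ^+ m k) = \sum_k ln (x k) *+ m k.
Proof.
move=> x0; suff [] : 0 < \prod_k x k ^+ m k /\
   ln (\prod_k x k ^+ m k) = \sum_k ln (x k) *+ m k by [].
elim/big_ind2: _ => [|a b c e [a0 ab] [c0 ce]|k _]; first by rewrite ln1.
  by rewrite mulr_gt0 // lnM // ab ce.
by rewrite exprn_gt0 // lnXn.
Qed.

Definition rexp (x : R) : R := Rtrigo_def.exp x.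

Lemma rexp_gt0 x : 0 < rexp x.
Proof. exact/RltP/exp_pos. Qed.

Lemma rexpD x y : rexp (x + y) = rexp x * rexp y.
Proof. exact: exp_plus. Qed.

Lemma lnK (x : R) : 0 < x -> rexp (ln x) = x.
Proof. by move=> /RltP x0; exact: exp_ln. Qed.

Section Laurent.
Variables (K : fieldType) (n m : nat) (a : 'I_n -> 'rV[int]_m).

Definition expo (mu : 'X_{1..n}) : 'rV[int]_m := \sum_(j < n) a j *+ mu j.

(** Group the monomials by [expo]: on each group [Phi] is constant and the coefficients sum to
    zero. *)
Lemma laurent_kernel_sum (g : {mpoly K[n]}) (Phi : 'X_{1..n} -> K) :
  laurent_kernel a g -> (forall mu nu, expo mu = expo nu -> Phi mu = Phi nu) ->
  \sum_(mu <- msupp g) g@_mu * Phi mu = 0.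
Proof.
move=> kg PhiE; pose bs := undup [seq expo mu | mu <- msupp g].
rewrite big_seq (eq_bigr (fun mu => \sum_(b <- bs | expo mu == b) g@_mu * Phi mu)); last first.
  move=> mu mug; rewrite -big_filter (_ : [seq b <- bs | expo mu == b] = [:: expo mu]).
    by rewrite big_seq1.
  have mub : expo mu \in bs by rewrite mem_undup map_f.
  rewrite -(filter_pred1_uniq (undup_uniq _) mub).
  by apply: eq_filter => b /=; rewrite eq_sym.
rewrite -big_seq (exchange_big_dep predT) //= big1_seq // => b /andP[_].
rewrite mem_undup => /mapP[nu nug bE]; rewrite (eq_bigr (fun mu => g@_mu * Phi nu)).
  by rewrite -mulr_suml (kg b) mul0r.
by move=> mu /eqP e; rewrite (PhiE mu nu) // e.
Qed.

Lemma laurent_kernel_subset m' (a' : 'I_n -> 'rV[int]_m') (g : {mpoly K[n]}) :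
  (forall mu nu : 'X_{1..n}, expo mu = expo nu ->
     \sum_(j < n) a' j *+ mu j = \sum_(j < n) a' j *+ nu j) ->
  laurent_kernel a g -> laurent_kernel a' g.
Proof.
move=> H kg b; rewrite big_mkcond.
rewrite (eq_bigr (fun mu => g@_mu * (\sum_(j < n) a' j *+ mu j == b)%:R)).
  by apply: laurent_kernel_sum => // mu nu /H ->.
by move=> mu _; case: ifP; rewrite ?mulr1 ?mulr0.
Qed.

Lemma laurent_kernel_eval (g : {mpoly K[n]}) (x : 'I_n -> K) :
  laurent_kernel a g ->
  (forall mu nu : 'X_{1..n}, expo mu = expo nu ->
     \prod_i x i ^+ mu i = \prod_i x i ^+ nu i) -> g.@[x] = 0.
Proof. by move=> kg H; rewrite mevalE; exact: laurent_kernel_sum. Qed.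

End Laurent.

(** * The slack ideal *)

Lemma mxsub_diag_mul (A : comNzRingType) (v f k l : nat) (r : 'I_k -> 'I_v) (c : 'I_l -> 'I_f)
    (a : 'I_v -> A) (b : 'I_f -> A) (M : 'M[A]_(v, f)) :
  mxsub r c (diag_mx (\row_i a i) *m M *m diag_mx (\row_j b j)) =
  diag_mx (\row_i a (r i)) *m mxsub r c M *m diag_mx (\row_j b (c j)).
Proof. by apply/matrixP => i j; rewrite mxE !mul_mx_diag !mul_diag_mx !mxE. Qed.

Section SlackIdeal.
Variables (d v f : nat) (p : 'I_v -> 'rV[R]_d) (F : 'I_f -> 'rV[R]_d * R).
Local Notation C := (complex R).
Local Notation vset := (vset p F).
Local Notation n := (nvars p F).
Implicit Types (N : 'M[R]_(v, f)) (g : slack_ring p F).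

Definition nonincid_val (k : 'I_n) : 'I_v * 'I_f := val (enum_val k : nonincid p F).

Lemma nonincid_valP k : (nonincid_val k).1 \notin vset (nonincid_val k).2.
Proof. by rewrite inE; exact: (valP (enum_val k : nonincid p F)). Qed.

Variant slack_entry_spec i j : slack_ring p F -> Prop :=
| SlackEntry0 of i \in vset j : slack_entry_spec i j 0
| SlackEntryX k of nonincid_val k = (i, j) : slack_entry_spec i j 'X_k.

Lemma slack_entryP i j : slack_entry_spec i j (slack_matrix p F i j).
Proof.
rewrite mxE; case: insubP => [u iu uE|] /=.
  by apply: SlackEntryX; rewrite /nonincid_val enum_rankK.
by rewrite negbK => ij; apply: SlackEntry0; rewrite inE.
Qed.

Lemma nonincid_ex i j : i \notin vset j -> exists k, nonincid_val k = (i, j).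
Proof.
move=> ij; have nij : ~~ incident p F (i, j).1 (i, j).2 by rewrite inE in ij.
exists (enum_rank (Sub (i, j) nij : nonincid p F)).
by rewrite /nonincid_val enum_rankK SubK.
Qed.

Definition pt N (k : 'I_n) : C := real_complex R (N (nonincid_val k).1 (nonincid_val k).2).

Lemma eval_slack_matrix N : has_pattern vset N ->
  map_mx (meval (pt N)) (slack_matrix p F) = map_mx (real_complex R) N.
Proof.
move=> pN; apply/matrixP => i j; rewrite mxE [RHS]mxE.
case: slack_entryP => [ij|k kE]; last by rewrite mevalXU /pt kE.
by rewrite meval0; have := (pN i j).2; rewrite ij => /eqP->; rewrite rmorph0.
Qed.

Lemma eval_minor N k (r : 'I_k -> 'I_v) (c : 'I_k -> 'I_f) : has_pattern vset N ->
  (\det (mxsub r c (slack_matrix p F))).@[pt N] = real_complex R (\det (mxsub r c N)).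
Proof.
by move=> pN; rewrite -det_map_mx map_mxsub eval_slack_matrix // -map_mxsub det_map_mx.
Qed.

Lemma minor_slack_ideal g : minors (d + 2) (slack_matrix p F) g -> slack_ideal p F g.
Proof.
move=> mg; exists 0%N, [:: (1, g)]; split=> [c|]; last by rewrite big_seq1 expr0.
by rewrite inE => /eqP->.
Qed.

Lemma pt_neq0 N k : has_pattern vset N -> pt N k != 0.
Proof. by move=> pN; rewrite /pt fmorph_eq0 (pN _ _).2 nonincid_valP. Qed.

(** No variable vanishes at a point with this pattern, so the monomial factor of the saturation can
    be cancelled after evaluation. *)
Lemma slack_ideal_eval N g : has_pattern vset N -> (\rank N <= d + 1)%N ->
  slack_ideal p F g -> g.@[pt N] = 0.
Proof.
move=> pN rN [e [s [sm /(congr1 (meval (pt N)))]]].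
rewrite mevalM rmorphXn rmorph_prod => /eqP; rewrite [X in _ == X](_ : _ = 0).
  rewrite mulf_eq0 expf_eq0 => /orP[/andP[_ /prodf_eq0[k _]]|/eqP//].
  by rewrite /= mevalXU (negPf (pt_neq0 k pN)).
rewrite raddf_sum /= big_seq big1 // => c cs.
rewrite mevalM; have [r [co [_ _ ->]]] := sm c cs.
by rewrite eval_minor // minor_eq0 ?rmorph0 ?mulr0 // addn2 ltnS -addn1.
Qed.

Lemma eval_slack_ideal_rank N : has_pattern vset N ->
  (forall g, slack_ideal p F g -> g.@[pt N] = 0) -> (\rank N <= d + 1)%N.
Proof.
move=> pN H; rewrite addn1; apply: rank_minors => r c ir ic.
have e : (d + 2)%N = d.+2 by rewrite addn2.
have /H : slack_ideal p F (\det (mxsub r c (slack_matrix p F))).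
  apply: minor_slack_ideal; rewrite e.
  by exists r, c.
by rewrite eval_minor // => /eqP; rewrite fmorph_eq0 => /eqP.
Qed.

Definition vexp (k : 'I_n) : 'X_{1..v + f} :=
  (U_(lshift f (nonincid_val k).1) + U_(rshift v (nonincid_val k).2))%MM.

Definition vexpo (mu : 'X_{1..n}) : 'X_{1..v + f} := (\sum_(k < n) vexp k *+ mu k)%MM.

Lemma nonincid_exp_row (mu : 'X_{1..n}) :
  \sum_(j < n) nonincid_exp (p := p) (F := F) j *+ mu j = \row_j (vexpo mu j)%:Z :> 'rV[int]_(v + f).
Proof.
apply/rowP => j; rewrite summxE [RHS]mxE /vexpo mnm_sumE.
rewrite -[RHS]natz natr_sum; apply: eq_bigr => k _.
rewrite mulmxnE mulmnE mnmDE !mnm1E /nonincid_exp -/(nonincid_val k) !mxE !eqxx /=.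
by rewrite natrM natrD mulr_natr ![j == _]eq_sym.
Qed.

Lemma vexpo_inj (mu nu : 'X_{1..n}) : vexpo mu = vexpo nu <->
  expo (nonincid_exp (p := p) (F := F)) mu = expo (nonincid_exp (p := p) (F := F)) nu.
Proof.
rewrite /expo !nonincid_exp_row; split=> [->//|e]; apply/mnmP => j.
by have /rowP/(_ j) := e; rewrite !mxE => -[].
Qed.

(* The homomorphism x_ij |-> s_i u_j, with values in the polynomial ring since all
   exponents involved are nonnegative. *)
Definition vmap : slack_ring p F -> {mpoly C[v + f]} :=
  mmap (@mpolyC (v + f) C) (fun k => 'X_[vexp k]).

Lemma vmapX (mu : 'X_{1..n}) : vmap 'X_[mu] = 'X_[vexpo mu].
Proof.
rewrite /vmap mmapX /mmap1 /vexpo (big_morph _ (@mpolyXD _ _) (mpolyX0 _ _)); apply: eq_bigr => k _.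
by rewrite mpolyXn.
Qed.

Lemma vmapE g : vmap g = \sum_(mu <- msupp g) g@_mu *: 'X_[vexpo mu].
Proof.
by apply: eq_bigr => mu _; rewrite -vmapX /vmap mmapX mul_mpolyC.
Qed.

Lemma vmap_eq0 g : vmap g = 0 -> nonincidence_toric p F g.
Proof.
move=> g0 b.
have [/hasP[nu nug /eqP bE]|/hasPn H] :=
  boolP (has (fun mu : 'X_{1..n} => \sum_(j < n) nonincid_exp (p := p) (F := F) j *+ mu j == b) (msupp g)); last first.
  by rewrite big_seq_cond big1 // => mu /andP[/H/negPf->].
rewrite -[RHS](mcoeff0 _ (vexpo nu)) -g0 vmapE raddf_sum /= big_mkcond.
apply: eq_bigr => mu _; rewrite mcoeffZ mcoeffX -bE.
have -> : (vexpo mu == vexpo nu) =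
  (\sum_(j < n) nonincid_exp (p := p) (F := F) j *+ mu j == \sum_(j < n) nonincid_exp (p := p) (F := F) j *+ nu j).
  by apply/eqP/eqP => /vexpo_inj.
by case: ifP; rewrite ?mulr1 ?mulr0.
Qed.

Lemma toric_binomial (mu nu : 'X_{1..n}) : vexpo mu = vexpo nu ->
  nonincidence_toric p F ('X_[mu] - 'X_[nu]).
Proof. by move=> e; apply: vmap_eq0; rewrite /vmap raddfB /= -!/(vmap _) !vmapX e subrr. Qed.

(** The slack matrix at the all-ones point. Under [vmap] the symbolic slack matrix becomes this
    matrix with rows scaled by the $s_i$ and columns by the $u_j$. *)
Definition supp_mx : 'M[R]_(v, f) := \matrix_(i, j) (i \notin vset j)%:R.

Lemma vmap_slack_matrix : map_mx vmap (slack_matrix p F) =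
  diag_mx (\row_i 'X_[U_(lshift f i)]) *m map_mx (@mpolyC (v + f) C) (map_mx (real_complex R) supp_mx)
   *m diag_mx (\row_j 'X_[U_(rshift v j)]).
Proof.
apply/matrixP => i j; rewrite mul_mx_diag mul_diag_mx mxE.
case: slack_entryP => [ij|k kE]; rewrite !mxE.
  by rewrite ij /= !rmorph0 mulr0 mul0r /vmap raddf0.
have := nonincid_valP k; rewrite kE /= => -> /=.
by rewrite !rmorph1 mulr1 /vmap mmapX mmap1U /vexp kE mpolyXD.
Qed.

Lemma vmap_minor k (r : 'I_k -> 'I_v) (c : 'I_k -> 'I_f) :
  (\rank supp_mx < k)%N -> vmap (\det (mxsub r c (slack_matrix p F))) = 0.
Proof.
move=> rk; rewrite /vmap -det_map_mx map_mxsub -/vmap vmap_slack_matrix.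
rewrite mxsub_diag_mul !det_mulmx -!map_mxsub !det_map_mx (minor_eq0 _ _ rk) !rmorph0.
by rewrite mulr0 mul0r.
Qed.

(** [vmap] sends the generating minors to multiples of vanishing minors of [supp_mx], and the
    product of the variables to a nonzero element of a domain. *)
Lemma slack_ideal_subset_toric g : (\rank supp_mx <= d + 1)%N ->
  slack_ideal p F g -> nonincidence_toric p F g.
Proof.
move=> rk [e [s [sm /(congr1 vmap)]]].
rewrite /vmap rmorphM rmorphXn rmorph_prod => /eqP; rewrite [X in _ == X](_ : _ = 0).
  rewrite mulf_eq0 expf_eq0 => /orP[/andP[_ /prodf_eq0[k _]]|/eqP]; last exact: vmap_eq0.
  rewrite /= mmapX mmap1U => /eqP/(congr1 (mcoeff (vexp k))).
  by rewrite mcoeffX eqxx mcoeff0 => /eqP; rewrite oner_eq0.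
rewrite raddf_sum /= big_seq big1 // => c cs.
rewrite rmorphM /=; have [r [co [_ _ ->]]] := sm c cs.
have := @vmap_minor _ r co; rewrite /vmap => -> //; first by rewrite mulr0.
by rewrite addn2 ltnS -addn1.
Qed.

(** Take logarithms: the toric binomials make the vector of [ln (x k)] orthogonal to all integer
    relations between the rows of the incidence matrix [A]. It is therefore $Aw$ for some [w], whose
    exponentials are [s] and [u]. *)
Lemma toric_point N : has_pattern vset N ->
  (forall g, nonincidence_toric p F g -> g.@[pt N] = 0) ->
  exists (s : 'I_v -> R) (u : 'I_f -> R),
    [/\ forall i, 0 < s i, forall j, 0 < u j
      & forall i j, i \notin vset j -> N i j = s i * u j].
Proof.
move=> pN H; pose x k := N (nonincid_val k).1 (nonincid_val k).2.
have x0 k : 0 < x k by rewrite lt0r (pN _ _).1 (pN _ _).2 nonincid_valP.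
pose A : 'M[int]_(n, v + f) := \matrix_k nonincid_exp (p := p) (F := F) k.
have [z zA|w wE] := @int_kernel_colspace _ _ _ A (\col_k ln (x k)).
  (* The positive and negative parts of the relation [z] are the exponents of a binomial. *)
  pose zp k := if 0 <= z 0 k then absz (z 0 k) else 0%N.
  pose zn k := if 0 <= z 0 k then 0%N else absz (z 0 k).
  pose mu := [multinom zp k | k < n]; pose nu := [multinom zn k | k < n].
  have zE k : z 0 k = (mu k)%:Z - (nu k)%:Z.
    by rewrite !mnmE /zp /zn; case: ifP => h; lia.
  have : vexpo mu = vexpo nu.
    apply/vexpo_inj/eqP; rewrite -subr_eq0 -sumrB; apply/eqP; rewrite -[RHS]zA.
    rewrite mulmx_sum_row; apply: eq_bigr => k _.
    by rewrite rowK zE scalerBl -!scaler_nat !natz.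
  move=> /toric_binomial/H; rewrite mevalB !mevalX => /eqP; rewrite subr_eq0.
  have ptE (m : 'X_{1..n}) : \prod_k pt N k ^+ m k = real_complex R (\prod_k x k ^+ m k).
    by rewrite rmorph_prod; apply: eq_bigr => k _; rewrite rmorphXn.
  rewrite !ptE => /eqP/fmorph_inj/(congr1 ln); rewrite !ln_monomial // => e.
  rewrite mxE; under eq_bigr => k _ do rewrite !mxE zE rmorphB mulrBl /= -!pmulrn !mulr_natl.
  by rewrite sumrB e subrr.
exists (fun i => rexp (w (lshift f i) 0)), (fun j => rexp (w (rshift v j) 0)).
split=> [i|j|i j ij]; try exact: rexp_gt0.
have [k kE] := nonincid_ex ij.
have AE l : (A k l)%:~R = (l == lshift f i)%:R + (l == rshift v j)%:R :> R.
  by rewrite mxE /nonincid_exp -/(nonincid_val k) kE !mxE rmorphD /= !rmorph_nat.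
have pick a : \sum_l (l == a)%:R * w l 0 = w a 0.
  by rewrite (bigD1 a) //= eqxx mul1r big1 ?addr0 // => l /negPf->; rewrite mul0r.
rewrite -rexpD -[LHS]lnK; last by rewrite lt0r (pN _ _).1 (pN _ _).2 ij.
congr rexp; have /colP/(_ k) := wE; rewrite mxE /x kE /= => ->.
rewrite mxE; under eq_bigr => l _ do rewrite mxE AE mulrDl.
by rewrite big_split /= !pick.
Qed.
End SlackIdeal.

(** * The two implications *)

Lemma is_face0 (d v : nat) (p : 'I_v -> 'rV[R]_d) : is_face p set0.
Proof.
apply/is_faceP; have E i : (hmat p *m ycol 0 1) i 0 = 1 by rewrite hmat_ycol dot0p subr0.
exists (ycol 0 1) => [i|]; first by rewrite E ler01.
by apply/setP => i; rewrite !inE E oner_eq0.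
Qed.

(** Vertices are the minimal nonempty faces, so an isomorphism of face posets carries singletons to
    singletons. *)
Lemma comb_equiv_vertices (d v w : nat) (p : 'I_v -> 'rV[R]_d) (q : 'I_w -> 'rV[R]_d) :
  vertex_family p -> vertex_family q -> comb_equiv p q ->
  exists (k : 'I_v -> 'I_w) (g : 'I_w -> 'I_v), [/\ cancel k g, cancel g k
    & forall A, is_face p A -> exists2 T, is_face q T & forall i, (k i \in T) = (i \in A)].
Proof.
move=> vp vq [phi [phiF phiO phiS]].
have fp i := vertex_exposed vp i; have fq i := vertex_exposed vq i.
have f0 := is_face0 p.
have phi0 : phi set0 = set0.
  have [A Af AE] := phiO _ (is_face0 q).
  by apply/eqP; rewrite -subset0 -AE -phiS // sub0set.
have phi1 i : exists k, phi [set i] = [set k].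
  have /set0Pn[k ki] : phi [set i] != set0.
    apply/eqP => e; have : [set i] \subset set0 by rewrite phiS // e sub0set.
    by rewrite subset0 => /eqP/setP/(_ i); rewrite !inE eqxx.
  have [A Af AE] := phiO _ (fq k).
  have : A \subset [set i] by rewrite phiS // AE sub1set.
  rewrite subset1 => /orP[/eqP Ai|/eqP A0]; first by exists k; rewrite -Ai.
  by move: AE; rewrite A0 phi0 => /setP/(_ k); rewrite !inE eqxx.
have [k kE] := fin_all_exists phi1.
have kM A i : is_face p A -> (k i \in phi A) = (i \in A).
  by move=> Af; rewrite -!sub1set -kE phiS.
have ik : injective k.
  move=> i j e; have : i \in [set j] by rewrite -kM // kE inE e.
  by rewrite inE => /eqP.
have /fin_all_exists[g gE] l : exists i, k i = l.
  have [A Af AE] := phiO _ (fq l).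
  have /set0Pn[i iA] : A != set0.
    apply/eqP => A0; move: AE; rewrite A0 phi0 => /setP/(_ l); by rewrite !inE eqxx.
  by exists i; apply/eqP; rewrite -in_set1 -AE kM.
exists k, g; split=> // [i|A Af]; first by apply: ik; rewrite gE.
by exists (phi A); [exact: phiF|move=> i; exact: kM].
Qed.

Section Main.
Variables (d v f : nat) (p : 'I_v -> 'rV[R]_d) (F : 'I_f -> 'rV[R]_d * R).
Hypotheses (vp : vertex_family p) (fp : full_dim p) (lF : facet_labelling p F).
Hypothesis d0 : (0 < d)%N.
Local Notation S := (smat p F).
Local Notation vset := (vset p F).
Local Notation n := (nvars p F).

Lemma toric_proj_unique :
  (forall g, nonincidence_toric p F g -> slack_ideal p F g) -> proj_unique p.
Proof.
move=> TI w q vq ce; have pS := smat_pattern lF; have rS := smat_rank fp lF d0.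
have [k [g [kg gk kF]]] := comb_equiv_vertices vp vq ce.
(* For each facet of [p], take a valid functional on [q] cutting out the corresponding face; the
   resulting matrix has the pattern of [S] and factors through dimension $d+1$. *)
have /fin_all_exists2[y y0 yE] j : exists2 y : 'cV[R]_(d + 1), forall l, 0 <= (hmat q *m y) l 0
    & forall i, ((hmat q *m y) (k i) 0 == 0) = (i \in vset j).
  have [|T /is_faceP[y y0 ->] TE] := kF (vset j).
    apply/is_faceP; exists (ycol (F j).1 (F j).2); last exact: vset_zeros.
    by move=> i; rewrite -smat_ycol (pS i j).1.
  by exists y => // i; rewrite -TE inE.
pose Y : 'M[R]_(d + 1, f) := \matrix_(i, j) y j i 0.
pose H := rowsub k (hmat q).
have NE i j : (H *m Y) i j = (hmat q *m y j) (k i) 0.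
  by rewrite !mxE; apply: eq_bigr => l _; rewrite !mxE.
have pN : has_pattern vset (H *m Y) by move=> i j; rewrite NE yE.
have rN : (\rank (H *m Y) <= d + 1)%N.
  by apply: leq_trans (mxrankM_maxr _ _) _; exact: rank_leq_row.
have [s [u [s0 u0 Nsu]]] := toric_point pN (fun g Tg => slack_ideal_eval pN rN (TI g Tg)).
have [|s' [u' [s'0 u'0 Ssu]]] := toric_point pS.
  by move=> h Th; apply: slack_ideal_eval (TI h Th); rewrite ?rS.
pose c i := s' i / s i.
have c0 i : 0 < c i by rewrite divr_gt0.
have NS : H *m Y = diag_mx (\row_i (c i)^-1) *m S *m diag_mx (\row_j (u j / u' j)).
  apply/matrixP => i j; rewrite mul_mx_diag mul_diag_mx [RHS]mxE [X in X * _]mxE ![(\row_ _ _) _ _]mxE.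
  have [ij|ij] := boolP (i \in vset j).
    have /eqP -> : (H *m Y) i j == 0 by rewrite (pN i j).2.
    have /eqP -> : S i j == 0 by rewrite (pS i j).2.
    by rewrite mulr0 mul0r.
  by rewrite Nsu // Ssu // /c; field; rewrite !gt_eqF.
have uD : diag_mx (\row_i (c i)^-1) \in unitmx.
  rewrite unitmxE det_diag unitfE; apply/prodf_neq0 => i _.
  by rewrite mxE invr_eq0 gt_eqF.
have uE : diag_mx (\row_j (u j / u' j)) \in unitmx.
  rewrite unitmxE det_diag unitfE; apply/prodf_neq0 => i _.
  by rewrite mxE gt_eqF // divr_gt0.
have rNE : \rank (H *m Y) = (d + 1)%N.
  by rewrite NS mxrankMfree ?row_free_unit // eqmxMfull ?row_full_unit.
(* [H] has $d+1$ columns, which is the rank of [H *m Y], so both have the same column space. It lies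
   in that of the rescaled [hmat p], and the change of coordinates is the projective map. *)
have sH : ((H *m Y)^T <= H^T)%MS by rewrite trmx_mul submxMl.
have HN : (H^T <= (H *m Y)^T)%MS.
  rewrite -(mxrank_leqif_sup sH) eqn_leq mxrankS //= !mxrank_tr rNE.
  exact: rank_leq_col.
have : (H^T <= (diag_mx (\row_i (c i)^-1) *m hmat p)^T)%MS.
  apply: submx_trans HN _; rewrite NS /smat -!mulmxA mulmxA trmx_mul; exact: submxMl.
case/submxP => D /(congr1 trmx); rewrite trmxK trmx_mul trmxK => HE.
have uM : D^T \in unitmx.
  rewrite -row_full_unit /row_full eqn_leq rank_leq_col -[leqLHS]rNE.
  apply: leq_trans (mxrankM_maxl _ _) _; rewrite HE; exact: mxrankM_maxr.
apply: (proj_equiv_vertex_map kg gk uM c0) => i.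
have /(congr1 (row i)) := HE; rewrite !row_mul row_diag_mx mxE -!scalemxAl -rowE row_hmat.
have -> : row i H = row_mx (q (k i)) 1 by rewrite -row_hmat; apply/rowP => l; rewrite !mxE.
by move=> ->; rewrite scalerA mulfV ?scale1r // gt_eqF.
Qed.

Definition mx_of (x : 'I_n -> R) : 'M[R]_(v, f) :=
  \matrix_(i, j) oapp (fun u : nonincid p F => x (enum_rank u)) 0 (insub (i, j)).

Lemma mx_ofE x k : mx_of x (nonincid_val k).1 (nonincid_val k).2 = x k.
Proof.
rewrite mxE -surjective_pairing; case: insubP => [u _ uE|] /=.
  by congr x; apply: (canLR enum_valK); apply: val_inj.
by rewrite (valP (enum_val k : nonincid p F)).
Qed.

Lemma mx_of_pattern x : (forall k, 0 < x k) -> has_pattern vset (mx_of x).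
Proof.
move=> x0 i j; have [ij|ij] := boolP (i \in vset j).
  suff -> : mx_of x i j = 0 by rewrite lexx eqxx.
  by rewrite mxE; case: insubP => //= u; rewrite inE in ij; rewrite ij.
have [k kE] := nonincid_ex ij; have := mx_ofE x k; rewrite kE /= => ->.
by rewrite ltW // gt_eqF.
Qed.

(** Both products are values of the monomial ['X_[vexpo mu]] at the point with coordinates [s] and
    [u]. *)
Lemma rank1_monomial (s : 'I_v -> R) (u : 'I_f -> R) (mu nu : 'X_{1..n}) :
  vexpo mu = vexpo nu ->
  \prod_k (s (nonincid_val k).1 * u (nonincid_val k).2) ^+ mu k =
  \prod_k (s (nonincid_val k).1 * u (nonincid_val k).2) ^+ nu k.
Proof.
pose h (j : 'I_(v + f)) := match split j with inl i => s i | inr j => u j end.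
suff E (m : 'X_{1..n}) :
    \prod_k (s (nonincid_val k).1 * u (nonincid_val k).2) ^+ m k = 'X_[vexpo m].@[h].
  by move=> e; rewrite !E e.
rewrite /vexpo (big_morph _ (@mpolyXD _ _) (mpolyX0 _ _)) rmorph_prod.
apply: eq_bigr => k _; rewrite -mpolyXn rmorphXn /= /vexp mpolyXD mevalM !mevalXU /h.
by rewrite (unsplitK (inl _)) (unsplitK (inr _)).
Qed.

Lemma proj_unique_toric (m : nat) (a : 'I_n -> 'rV[int]_m) : proj_unique p ->
  (forall g, slack_ideal p F g <-> laurent_kernel a g) ->
  forall g, slack_ideal p F g <-> nonincidence_toric p F g.
Proof.
move=> up Ia; have pS := smat_pattern lF.
have onV (x : 'I_n -> R) : (forall k, 0 < x k) ->
    (forall mu nu : 'X_{1..n}, expo a mu = expo a nu -> \prod_k x k ^+ mu k = \prod_k x k ^+ nu k) ->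
    forall g, slack_ideal p F g -> g.@[pt (mx_of x)] = 0.
  move=> x0 H g /Ia kg; apply: (laurent_kernel_eval kg) => mu nu /H e.
  have E (m' : 'X_{1..n}) : \prod_k pt (p := p) (F := F) (mx_of x) k ^+ m' k =
      real_complex R (\prod_k x k ^+ m' k).
    by rewrite rmorph_prod; apply: eq_bigr => k _; rewrite rmorphXn /pt mx_ofE.
  by rewrite !E e.
(* All monomials agree at the all-ones point, so it lies on the slack variety and the support matrix
   has rank at most $d+1$. *)
pose one (k : 'I_n) : R := 1; have one0 k : 0 < one k by exact: ltr01.
have p1 := mx_of_pattern one0.
have r1 : (\rank (mx_of one) <= d + 1)%N.
  apply: (eval_slack_ideal_rank p1); apply: onV => // mu nu _.
  by rewrite !big1 // => k _; rewrite expr1n.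
have [s' [u' [s'0 u'0 SE]]] : exists (s : 'I_v -> R) (u : 'I_f -> R),
    [/\ forall i, 0 < s i, forall j, 0 < u j
      & forall i j, i \notin vset j -> S i j = s i * u j].
  have [sigma [tau [s [u [isig itau s0 u0 E]]]]] := realize vp fp lF d0 up p1 r1.
  have [sg sK Ks] : bijective sigma by apply: injF_bij.
  have [tg tK Kt] : bijective tau by apply: injF_bij.
  exists (fun i => (s (sg i))^-1), (fun j => (u (tg j))^-1).
  split=> [i|j|i j ij]; rewrite ?invr_gt0 //.
  have Ne : mx_of one (sg i) (tg j) != 0.
    have S0 : S i j != 0 by rewrite (pS i j).2.
    by rewrite E Ks Kt (mulf_neq0 (mulf_neq0 (lt0r_neq0 (s0 _)) (lt0r_neq0 (u0 _))) S0).
  have : mx_of one (sg i) (tg j) = 1.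
    have : sg i \notin vset (tg j) by rewrite -(p1 _ _).2.
    by move=> /nonincid_ex[k kE]; have := mx_ofE one k; rewrite kE.
  rewrite E Ks Kt -invfM => e.
  have su : s (sg i) * u (tg j) != 0 by rewrite mulf_neq0 // gt_eqF.
  by apply: (mulfI su); rewrite e mulfV.
move=> g; split=> [|Tg].
  apply: slack_ideal_subset_toric; apply: leq_trans r1; apply: eq_leq; congr mxrank.
  apply/matrixP => i j; rewrite mxE; have [ij|ij] := boolP (i \in vset j).
    by apply/esym/eqP; rewrite (p1 i j).2.
  by have [k kE] := nonincid_ex ij; have := mx_ofE one k; rewrite kE.
apply/Ia; apply: laurent_kernel_subset Tg => mu nu /vexpo_inj e.
(* Integer powers of 2 are distinct, so values of monomials at this point detect the [l]-th
   coordinate of their exponents. *)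
apply/rowP => l; pose x k : R := 2%:R ^ (a k 0 l).
have x0 k : 0 < x k by rewrite exprz_gt0.
have xE (m' : 'X_{1..n}) : \prod_k x k ^+ m' k = 2%:R ^ (expo a m' 0 l).
  rewrite /expo summxE; under [in RHS]eq_bigr do rewrite mulmxnE.
  rewrite (big_morph (fun z : int => 2%:R ^ z : R) (id1 := 1) (op1 := *%R)) //; last first.
    by move=> y z; rewrite expfzDr ?pnatr_eq0.
  by apply: eq_bigr => k _; rewrite -[a k 0 l *+ _]mulr_natr natz -exprz_exp.
have pX := mx_of_pattern x0.
have rX : (\rank (mx_of x) <= d + 1)%N.
  apply: (eval_slack_ideal_rank pX); apply: onV => // m1 m2 h.
  by rewrite !xE h.
have [sigma [tau [s [u [_ _ s0 u0 E]]]]] := realize vp fp lF d0 up pX rX.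
have xsu k : x k = (s (nonincid_val k).1 * s' (sigma (nonincid_val k).1)) *
                   (u (nonincid_val k).2 * u' (tau (nonincid_val k).2)).
  rewrite -mx_ofE E SE; first by ring.
  rewrite -(pS _ _).2; apply: contraTneq (x0 k) => e1.
  by rewrite -mx_ofE E e1 mulr0 ltxx.
have : \prod_k x k ^+ mu k = \prod_k x k ^+ nu k.
  under eq_bigr do rewrite xsu; under [RHS]eq_bigr do rewrite xsu.
  exact: (rank1_monomial (fun i => s i * s' (sigma i)) (fun j => u j * u' (tau j)) e).
rewrite !xE; apply: ieexprIz => //.
by rewrite eq_sym lt_eqF // ltr1n.
Qed.

End Main.

(** A facet needs a nonzero normal vector, so there are no facets in dimension zero; then there are
    no variables and both ideals are zero. *)
Lemma zero_dim_case (v f : nat) (p : 'I_v -> 'rV[R]_0) (F : 'I_f -> 'rV[R]_0 * R) :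
  full_dim p -> facet_labelling p F ->
  (forall g, slack_ideal p F g <-> nonincidence_toric p F g) /\ proj_unique p.
Proof.
move=> [r [rc _]] lF; have f0 (j : 'I_f) : False.
  by case: lF => /(_ j)[/eqP + _ _] _ _; apply; apply: thinmx0.
have n0 (k : 'I_(nvars p F)) : False by exact: f0 (nonincid_val k).2.
split=> [g|w q vq [phi [phiF phiO phiS]]].
  have [s0 t0] : (slack_ideal p F g -> g = 0) /\ (nonincidence_toric p F g -> g = 0).
    split=> [[e [s [sm /eqP]]]|Tg].
      rewrite [X in _ == X](_ : _ = 0).
        rewrite mulf_eq0 expf_eq0 => /orP[/andP[_ /prodf_eq0[k _]]|/eqP//].
        by case: (n0 k).
      rewrite big_seq big1 // => c cs; have [_ [c' _]] := sm c cs.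
      by case: (f0 (c' ord0)).
    apply/mpolyP => m; rewrite mcoeff0 {1}[g]mpolyE raddf_sum /=.
    rewrite (eq_bigr (fun mu => g@_mu * (mu == m)%:R)); last first.
      by move=> mu _; rewrite mcoeffZ mcoeffX.
    apply: (laurent_kernel_sum Tg) => mu nu _.
    suff -> : mu = nu by [].
    by apply/mnmP => k; case: (n0 k).
  split=> [/s0->|/t0->].
    by move=> b; rewrite msupp0 big_nil.
  by exists 0%N, [::]; rewrite big_nil mulr0.
have x0 := rc ord0.
(* If [q] had no points, its only face would be the empty one, whereas [p] has two faces. *)
have [i0] : exists i0 : 'I_w, true.
  have [l _|w0] := pickP 'I_w; first by exists l.
  have pT : is_face p setT.
    apply/is_faceP; exists 0 => [i|]; rewrite ?mulmx0 ?mxE //.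
    by apply/setP => i; rewrite !inE mulmx0 mxE eqxx.
  have sT : setT \subset (set0 : {set 'I_v}).
    rewrite phiS //; last exact: is_face0.
    by apply/subsetP => l; have := w0 l.
  have [i1] : exists i : 'I_v, true.
    case: x0 => lam [_ _ s1 _]; have [k _|v0] := pickP 'I_v; first by exists k.
    by move: s1; rewrite big1 => [/eqP|k]; [rewrite eq_sym oner_eq0|have := v0 k].
  by move=> _; have := subsetP sT i1; rewrite !inE => /(_ isT).
move=> _; exists 1%:M; split=> [|x _|x _|y _].
- exact: unitmx1.
- by rewrite /hom_img mulmx1 row_mxKr mxE oner_eq0.
- by rewrite (_ : proj_map _ _ = q i0); [exact: in_conv_vertex|rewrite [LHS]thinmx0 [RHS]thinmx0].
- by exists (r ord0) => //; rewrite [LHS]thinmx0 [RHS]thinmx0.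
Qed.

Theorem theorem4p3 (d v f : nat) (p : 'I_v -> 'rV[R]_d)
    (F : 'I_f -> 'rV[R]_d * R) :
  vertex_family p -> full_dim p -> facet_labelling p F ->
  ((forall g, slack_ideal p F g <-> nonincidence_toric p F g) <->
   (proj_unique p /\ is_toric (slack_ideal p F))).
Proof.
move=> vp fp lF.
have toricI : (forall g, slack_ideal p F g <-> nonincidence_toric p F g) ->
    is_toric (slack_ideal p F).
  by move=> IT; exists (v + f)%N, (nonincid_exp (p := p) (F := F)).
case: (posnP d) => [dz|d0].
  have [IT up] : (forall g, slack_ideal p F g <-> nonincidence_toric p F g) /\ proj_unique p.
    by move: p F fp lF {vp toricI}; rewrite dz => p' F' fp' lF'; exact: zero_dim_case.
  by split=> // _; split=> //; exact: toricI.
split=> [IT|[up [m [a Ia]]]]; last exact: (proj_unique_toric vp fp lF d0 up Ia).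
by split; [apply: (toric_proj_unique vp fp lF d0) => g /IT | exact: toricI].
Qed.
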